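(* Let $b$ and $n$ be two integers such that $b\geq 2$ and $1\leq n\leq b$. Let $\lambda>0$. Then there exists a connected metric graph $\Gamma$ of first Betti number $b$ and of length equal to $b$ such that there are at most $\lfloor \lambda(\log(b)+n)\rfloor+1$ homologically independent loops in $\Gamma$ based at the same point of length at most $\lambda(\log(b)+n)$; that is, any homologically independent family of loops in $\Gamma$ that are all based at one common point and all of length at most $\lambda(\log(b)+n)$ has at most $\lfloor \lambda(\log(b)+n)\rfloor+1$ members.
   Context: $\log$ denotes the natural logarithm and $\lfloor\cdot\rfloor$ the integral part. A graph is a finite one-dimensional CW-complex (multiple edges and loops are allowed). A metric graph is a graph endowed with a length space metric; the length of a (sub)graph is its one-dimensional Hausdorff measure. The first Betti number of a graph is $e-v+c$, where $e$, $v$, $c$ are the numbers of edges, vertices and connected components. A family of loops in $\Gamma$ is homologically independent if their homology classes in $H_1(\Gamma,\mathbb{R})$ are linearly independent. *)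

(* Defs.v *)
From HB Require Import structures.
From mathcomp Require Import all_boot all_order all_algebra finmap.
From mathcomp Require Import all_classical all_reals all_analysis.
Import Order.TTheory GRing.Theory Num.Theory.
Import numFieldTopology.Exports numFieldNormedType.Exports.

Set Implicit Arguments.
Unset Strict Implicit.
Unset Printing Implicit Defensive.

Local Open Scope classical_set_scope.
Local Open Scope ring_scope.

(* Paths are functions on the whole of R, of which only the restriction to
   [0, 1] is meaningful. *)
Definition is_path (R : realType) (X : topologicalType) (x y : X)
    (g : R -> X) : Prop :=
  [/\ {within `[0, 1], continuous g}, g 0 = x & g 1 = y].

Definition is_loop (R : realType) (X : topologicalType) (x : X)
    (g : R -> X) : Prop := is_path x x g.

(* The metric-valued analogue of [total_variation 0 1]. *)
Definition path_length (R : realType) (X : metricType R) (g : R -> X)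
    : \bar R :=
  ereal_sup [set (\sum_(0 <= i < size s)
                    mdist (g (nth 1 (0 :: s) i))
                          (g (nth 1 (0 :: s) i.+1)))%:E
            | s in itv_partition 0 1].

(* The infimum of the empty set is +oo, and the distance of a [metricType] is
   finite, so that a length space in this sense is path-connected. *)
Definition length_space (R : realType) (X : metricType R) : Prop :=
  forall x y : X,
    (mdist x y)%:E = ereal_inf [set path_length g | g in @is_path R X x y].

Section Hausdorff.
Context (R : realType) (X : metricType R).
Local Open Scope ereal_scope.

(* The element 0 only matters for the empty set. *)
Definition diameter (A : set X) : \bar R :=
  ereal_sup (0 |` [set (mdist p.1 p.2)%:E | p in A `*` A]).

Definition hausdorff1_pre (d : R) (A : set X) : \bar R :=
  ereal_inf [set \sum_(0 <= i <oo) diameter (U i)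
            | U in [set U : nat -> set X | A `<=` \bigcup_i U i /\
                                           forall i, diameter (U i) <= d%:E]].

Definition hausdorff1 (A : set X) : \bar R :=
  ereal_sup [set hausdorff1_pre d A | d in [set d : R | (0 < d)%R]].

End Hausdorff.

(* A finite CW structure of dimension at most 1: the characteristic map of a
   1-cell sends 0 and 1 to 0-cells, possibly the same one, and the 0-cells and
   the open 1-cells partition X.  As there are finitely many cells, when X is
   Hausdorff its topology is automatically the weak one. *)
Record graph_structure (R : realType) (X : topologicalType) :=
  GraphStructure {
    vertex : finType;
    edge : finType;
    vertex_pt : vertex -> X;
    edge_map : edge -> R -> X;
    vertex_pt_inj : injective vertex_pt;
    edge_map_continuous :
      forall e, {within `[0, 1], continuous (edge_map e)};
    edge_map0 : forall e, range vertex_pt (edge_map e 0);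
    edge_map1 : forall e, range vertex_pt (edge_map e 1);
    edge_map_inj : forall e e' (s t : R), s \in `]0, 1[ -> t \in `]0, 1[ ->
      edge_map e s = edge_map e' t -> e = e' /\ s = t;
    edge_map_vertex : forall e (s : R), s \in `]0, 1[ ->
      ~ range vertex_pt (edge_map e s);
    graph_cover : forall x : X, range vertex_pt x \/
      exists e, exists2 s : R, s \in `]0, 1[ & edge_map e s = x
  }.

Definition betti1 (R : realType) (X : topologicalType)
    (G : graph_structure R X) : int :=
  #|edge G|%:Z - #|vertex G|%:Z
  + #|` fset_set [set connected_component [set: X] x | x in [set: X]]|%:Z.

Record metricGraph (R : realType) := MetricGraph {
  mg_space :> metricType R;
  mg_graph : graph_structure R mg_space;
  mg_length_space : length_space mg_space
}.

Definition graph_length (R : realType) (G : metricGraph R) : \bar R :=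
  hausdorff1 [set: G].

(* Singular chains with coefficients in R.  Singular 1-simplices are the paths
   up to equality on [0, 1], and a 1-chain is represented by its coefficient
   function; singular 2-simplices are the continuous maps on the triangle with
   ordered vertices (0, 0), (1, 0), (0, 1). *)
Section Homology.
Context (R : realType) (X : topologicalType).

Definition simplex1 (g : R -> X) : (R -> X) -> R :=
  fun h => `[< {in `[0, 1], g =1 h} >]%:R.

Definition triangle : set (R * R) :=
  [set p | [/\ 0 <= p.1, 0 <= p.2 & p.1 + p.2 <= 1]].

Definition boundary2 (f : R * R -> X) : (R -> X) -> R :=
  fun h => simplex1 (fun t => f (1 - t, t)) h
         - simplex1 (fun t => f (0, t)) h
         + simplex1 (fun t => f (t, 0)) h.

Definition is_boundary (c : (R -> X) -> R) : Prop :=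
  exists (N : nat) (a : 'I_N -> R) (f : 'I_N -> R * R -> X),
    (forall j, {within triangle, continuous (f j)}) /\
    forall h, c h = \sum_(j < N) a j * boundary2 (f j) h.

(* Linear independence of the classes of the [g i] in H_1(X, R). *)
Definition homologically_independent (m : nat) (g : 'I_m -> R -> X) : Prop :=
  forall k : 'I_m -> R,
    is_boundary (fun h => \sum_(i < m) k i * simplex1 (g i) h) ->
    forall i, k i = 0.

End Homology.

(* Main.v *)
Require Import Defs.
From HB Require Import structures.
From mathcomp Require Import all_boot all_order all_algebra finmap.
From mathcomp Require Import all_classical all_reals all_analysis.
From mathcomp Require Import ring lra.
Import Order.TTheory GRing.Theory Num.Theory.
Import numFieldTopology.Exports numFieldNormedType.Exports.
Local Open Scope classical_set_scope.
Local Open Scope ring_scope.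

(** Write [b = c + 1] and [L = lambda (log b + n)].  A single graph works for
    all values of [L]: the spine [0, c] with a small circle of length [1 / b]
    attached at each of the [b] integers.  Its length is [c + b / b = b], its
    first Betti number is [b], and the spine keeps the circles apart.  A loop
    based at [x] that goes around the circle at [j] passes through the point
    of that circle antipodal to [j], so its length is at least twice the
    distance from [x] to that point, hence at least [2 |u - j|], where [u] is
    the projection of [x] to the spine.  A loop of length at most [L]
    therefore only goes around circles with [|u - j| <= L / 2], and an interval
    of length [L] contains at most [floor L + 1] integers
    ([card_posts_near]).

    Three facts about this graph, the necklace, need work.

    It is a metric graph of length [b].  The distance is given by an explicit
    formula, and geodesics are glued from segments of the spine and arcs of
    circles ([necklace_geodesic]).  For the Hausdorff measure, cutting the
    edges into equal pieces bounds it above.  For the lower bound, the edges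
    are laid end to end on [0, b]: away from the vertices and the antipodes,
    this does not increase the diameter of sets of small diameter, so a cover of
    the necklace yields a cover of most of [0, b] by intervals of the same
    lengths ([necklace_length_ge]).

    Every loop [g] is homologous to a combination of [b] fixed chains
    [turn j], where [turn j] has coefficient zero unless [g] visits the
    antipode of [j] ([loop_homologous]).  Unrolling the circles turns the
    necklace into a contractible tree, made of the spine and of a whole line
    through each integer.  A path that lifts to the tree is homologous to the
    difference of the rays from the root to its lifted end points, by the
    contraction of the tree ([tree_path_homologous]).  A short path always
    lifts: if it avoids all antipodes one may cut the circles there, and
    otherwise it stays on one circle minus its attaching point.  Comparing
    the lift with the standard one only costs a multiple of [turn j], and
    that only in the second case ([short_path_homologous]).  Around a loop
    the contributions of the rays cancel.

    Finally, if there were more loops than circles within reach, the matrix of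
    their coefficients would have a nontrivial left kernel, and a nontrivial
    combination of the loops would be a boundary ([independent_loops_le]). *)

Set Implicit Arguments.
Unset Strict Implicit.
Unset Printing Implicit Defensive.

(** * Arithmetic modulo the length of a circle *)

Section Cmod.
Context (R : realType) (l : R).
Context (l_gt0 : 0 < l).

(** The representative of [x] modulo [l] in the half-open interval from
    [- l / 2] to [l / 2]; it jumps at the odd multiples of [l / 2], which will
    be the antipodes of the attaching points. *)
Definition cmod (x : R) : R := x - (Num.ceil (x / l - 2^-1))%:~R * l.

(** The distance from [x] to the lattice of multiples of [l], that is, the
    distance of [x] to [0] on a circle of length [l]. *)
Definition cnorm (x : R) : R := `|cmod x|.

Lemma cmod_itv x : - (l / 2) < cmod x <= l / 2.
Proof.
rewrite /cmod; set k := Num.ceil _.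
have : (k - 1)%:~R < x / l - 2^-1 <= k%:~R := ceil_itv _.
rewrite rmorphB/= => /andP[k1 k2].
have xE : x = x / l * l by rewrite divfK// gt_eqF.
rewrite {1 2}xE; move: (x / l) k1 k2 => y k1 k2.
have [m0 m1] : 0 < l * (y - 2^-1 - (k%:~R - 1)) /\ 0 <= l * (k%:~R - (y - 2^-1)).
  by split; [apply: mulr_gt0 => //; lra | apply: mulr_ge0; [exact: ltW | lra]].
apply/andP; split; nra.
Qed.

(** Two multiples of [l] that bring [x] into the same half-open interval of
    length [l] differ by less than [l]. *)
Lemma cmod_unique (k : int) x :
  - (l / 2) < x - k%:~R * l <= l / 2 -> cmod x = x - k%:~R * l.
Proof.
move=> /andP[a1 a2]; have /andP[b1 b2] := cmod_itv x.
move: b1 b2; rewrite /cmod; set m := Num.ceil _ => b1 b2.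
suff -> : m = k by [].
have h (i j : int) : (i%:~R - j%:~R) * l < l -> i <= j.
  by rewrite -[ltRHS]mul1r ltr_pM2r// -rmorphB -[1]/(1%:~R) ltr_int ltrBlDr
    addrC ltzD1.
by apply/eqP; rewrite eq_le !h//; lra.
Qed.

Lemma cmod_id x : - (l / 2) < x <= l / 2 -> cmod x = x.
Proof. by move=> h; rewrite (@cmod_unique 0) mul0r subr0. Qed.

Lemma cmod_eq x y : cmod x = cmod y -> exists k : int, x = y + k%:~R * l.
Proof.
rewrite /cmod; set m := Num.ceil _; set n := Num.ceil _ => /eqP.
rewrite subr_eq => /eqP ->; exists (m - n).
by rewrite rmorphB/= mulrBl addrA addrAC.
Qed.

Lemma cmod0 : cmod 0 = 0.
Proof. by have l0 := l_gt0; apply: cmod_id; apply/andP; split; lra. Qed.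

Lemma cmodDl (k : int) x : cmod (x + k%:~R * l) = cmod x.
Proof.
rewrite (@cmod_unique (k + Num.ceil (x / l - 2^-1))).
  by rewrite rmorphD/= /cmod; ring.
by have := cmod_itv x; rewrite /cmod rmorphD/= mulrDl addrKA.
Qed.

Lemma cnorm_ge0 x : 0 <= cnorm x. Proof. exact: normr_ge0. Qed.

Lemma cnormDl (k : int) x : cnorm (x + k%:~R * l) = cnorm x.
Proof. by rewrite /cnorm cmodDl. Qed.

Lemma cnorm_le_half x : cnorm x <= l / 2.
Proof.
by have /andP[] := cmod_itv x; rewrite /cnorm ler_norml => /ltW -> ->.
Qed.

(** A multiple of [l] other than the one chosen by [cmod] is at least [l] away
    from it, while [cmod x] is at most [l / 2]. The subadditivity of [cnorm]
    follows from this minimality. *)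
Lemma cnorm_min (k : int) x : cnorm x <= `|x - k%:~R * l|.
Proof.
have l0 := l_gt0; have h := cnorm_le_half x.
rewrite {1}/cnorm {1}/cmod; set m := Num.ceil _.
have [->//|mk] := eqVneq m k.
apply: le_trans h _.
have: 1 <= `|m - k|%:~R :> R.
  by rewrite -[1]/(1%:~R) ler_int -gtz0_ge1 normr_gt0 subr_eq0.
rewrite intr_norm rmorphB/= => mk1.
have : l <= `|(m%:~R - k%:~R) * l|.
  by rewrite normrM (gtr0_norm l_gt0) ler_peMl // ltW.
have := cnorm_le_half x; rewrite /cnorm /cmod -/m.
have -> : (m%:~R - k%:~R) * l = (x - k%:~R * l) - (x - m%:~R * l) by ring.
by have := ler_normB (x - k%:~R * l) (x - m%:~R * l); lra.
Qed.

Lemma cnorm_le x : cnorm x <= `|x|.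
Proof. by have := cnorm_min 0 x; rewrite mul0r subr0. Qed.

Lemma cmodK x : cmod (cmod x) = cmod x.
Proof. exact/cmod_id/cmod_itv. Qed.

Lemma cnormN x : cnorm (- x) = cnorm x.
Proof.
suff h y : cnorm (- y) <= cnorm y by apply/eqP; rewrite eq_le h -{1}[x]opprK h.
set k := Num.ceil (y / l - 2^-1).
have := cnorm_min (- k) (- y); rewrite rmorphN/= mulNr opprK.
by rewrite -[leRHS]normrN opprD !opprK.
Qed.

Lemma cnormD x y : cnorm (x + y) <= cnorm x + cnorm y.
Proof.
set j := Num.ceil (x / l - 2^-1); set k := Num.ceil (y / l - 2^-1).
apply: le_trans (cnorm_min (j + k) (x + y)) _.
rewrite rmorphD/= (_ : _ - _ = cmod x + cmod y); first exact: ler_normD.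
by rewrite /cmod -/j -/k; ring.
Qed.

Lemma cnorm0 : cnorm 0 = 0. Proof. by rewrite /cnorm cmod0 normr0. Qed.

Lemma cmod_subl x y : cmod (x - cmod y) = cmod (x - y).
Proof.
rewrite -(cmodDl (Num.ceil (y / l - 2^-1)) (x - y)); congr cmod.
by rewrite /cmod; ring.
Qed.

Lemma cnormB_cmod x y : cnorm (cmod x - cmod y) = cnorm (x - y).
Proof.
by rewrite /cnorm cmod_subl -[cmod x - y]opprB -/(cnorm _) cnormN /cnorm
  cmod_subl -/(cnorm _) -cnormN opprB.
Qed.

Lemma cnormB_eq0 x y : cnorm (x - y) = 0 -> cmod x = cmod y.
Proof.
move=> /normr0_eq0; rewrite {1}/cmod => /subr0_eq xy.
by rewrite -(subrK y x) xy addrC cmodDl.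
Qed.

(** The discontinuities of [cmod] are at distance [l / 2 - cnorm x] from [x]
    on the circle, so [cmod] is an isometry on the open ball of that radius. *)
Lemma cmod_near x y : cnorm (y - x) < l / 2 - cnorm x ->
  `|cmod y - cmod x| <= cnorm (y - x).
Proof.
move=> yx; set i := Num.ceil (x / l - 2^-1).
set j := Num.ceil ((y - x) / l - 2^-1).
have yE : y - (i + j)%:~R * l = cmod x + cmod (y - x).
  by rewrite /cmod -/i -/j rmorphD/=; ring.
suff -> : cmod y = cmod x + cmod (y - x) by rewrite addrAC subrr add0r.
rewrite -yE; apply: cmod_unique; rewrite yE.
have := ler_normD (cmod x) (cmod (y - x)); rewrite -!/(cnorm _) => h.
have : `|cmod x + cmod (y - x)| < l / 2 by lra.
by rewrite ltr_norml => /andP[-> /ltW ->].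
Qed.

End Cmod.

(** * Continuity, lengths and geodesics in metric spaces *)

Section MetricPaths.
Context (R : realType) (X : metricType R).

Lemma within_continuousE (U : pseudoMetricType R) (A : set U) (f : U -> X) :
  {within A, continuous f} <->
  forall x, A x -> forall e : R, 0 < e ->
    exists2 d : R, 0 < d & forall y, A y -> ball x d y -> mdist (f x) (f y) < e.
Proof.
split=> [/subspace_continuousP fc x Ax e e0|fc].
  have /cvg_ballP/(_ e e0) := fc x Ax.
  rewrite /within/= => /nbhs_ballP[d /= d0 h]; exists d => // y Ay xy.
  by have := h y xy Ay; rewrite ballEmdist.
apply/subspace_continuousP => x Ax; apply/cvg_ballP => e e0.
have [d d0 h] := fc x Ax e e0.
rewrite /within/=; apply/nbhs_ballP; exists d => //= y xy Ay.
by rewrite ballEmdist; exact: h.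
Qed.

Lemma lipschitz_within_continuous (A : set R) (D : R) (f : R -> X) : 0 <= D ->
  (forall s t, A s -> A t -> mdist (f s) (f t) <= D * `|s - t|) ->
  {within A, continuous f}.
Proof.
move=> D0 fD; apply/within_continuousE => x Ax e e0.
exists (e / (D + 1)) => [|y Ay]; first by rewrite divr_gt0// ltr_wpDl.
rewrite /ball/= => xy; apply: le_lt_trans (fD _ _ Ax Ay) _.
have D1 : 0 < D + 1 by rewrite ltr_wpDl.
have := xy; rewrite ltr_pdivlMr// mulrDr mulr1 mulrC.
by apply: le_lt_trans; rewrite lerDl.
Qed.

Lemma path_length_ge (g : R -> X) (t : R) : 0 <= t <= 1 ->
  ((mdist (g 0) (g t) + mdist (g t) (g 1))%:E <= path_length g)%E.
Proof.
move=> /andP[t0 t1].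
have h1 : ((mdist (g 0) (g 1))%:E <= path_length g)%E.
  apply: ereal_sup_ubound; exists [:: 1] => /=.
    by split; rewrite /= ?ltr01.
  by rewrite big_nat1.
have [->|tn0] := eqVneq t 0; first by rewrite mdistxx add0r.
have [->|tn1] := eqVneq t 1; first by rewrite mdistxx addr0.
apply: ereal_sup_ubound; exists [:: t; 1] => /=.
  by split; rewrite /= ?eqxx// !lt_neqAle eq_sym tn0 t0 tn1 t1.
by rewrite big_nat_recr//= big_nat1.
Qed.

(** The increments of the parameter along a partition sum up to [1]. *)
Lemma path_length_lipschitz (D : R) (g : R -> X) :
  (forall s t : R, 0 <= s <= 1 -> 0 <= t <= 1 ->
     mdist (g s) (g t) <= D * `|s - t|) ->
  (path_length g <= D%:E)%E.
Proof.
move=> gD; apply: ge_ereal_sup => _ [s sP <-]; rewrite lee_fin.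
apply: (@le_trans _ _ (\sum_(0 <= i < size s)
    (D * nth 1 (0 :: s) i.+1 - D * nth 1 (0 :: s) i))).
  rewrite !big_nat; apply: ler_sum => i /andP[_ ilt].
  have s01 k : (k < (size s).+1)%N -> 0 <= nth 1 (0 :: s) k <= 1.
    by move=> ks; rewrite (itv_partition_nth_ge ks sP) (itv_partition_nth_le ks sP).
  apply: le_trans (gD _ _ (s01 _ _) (s01 _ _)) _; first by rewrite ltnS ltnW.
  - by rewrite ltnS.
  - have [/(pathP 1)/(_ _ ilt) /= hi _] := sP.
    by rewrite ltr0_norm ?subr_lt0// opprB mulrBr.
have [_ /eqP] := sP; rewrite (last_nth 1) => s1.
by rewrite telescope_sumr// s1 mulr1 /= mulr0 subr0.
Qed.

(** A 1-Lipschitz path on [0, D]; parametrizing by [0, D] instead of [0, 1]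
    makes concatenation immediate. Such a path has length at most [D], so it
    is a shortest path only when [D] is the distance of its end points. *)
Definition geodesic (x y : X) (D : R) : Prop :=
  0 <= D /\ exists f : R -> X, [/\ f 0 = x, f D = y &
    forall s t : R, 0 <= s <= D -> 0 <= t <= D -> mdist (f s) (f t) <= `|s - t|].

Lemma geodesic_sym x y D : geodesic x y D -> geodesic y x D.
Proof.
move=> [D0 [f [f0 fD fl]]]; split=> //; exists (fun t => f (D - t)).
split; rewrite ?subr0 ?subrr// => s t /andP[s0 sD] /andP[t0 tD].
rewrite distrC (_ : t - s = D - s - (D - t)); last by ring.
by apply: fl; apply/andP; split; lra.
Qed.

(** By the triangle inequality through the common end point, gluing keeps the
    Lipschitz constant. *)
Lemma geodesic_trans y x z D E :
  geodesic x y D -> geodesic y z E -> geodesic x z (D + E).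
Proof.
move=> [D0 [f [f0 fD fl]]] [E0 [g [g0 gE gl]]]; split; first by rewrite addr_ge0.
pose h t := if t <= D then f t else g (t - D).
have hl (s t : R) : 0 <= s -> s <= t -> t <= D + E -> mdist (h s) (h t) <= t - s.
  move=> s0 st tDE; rewrite /h; have [tD|tD] := leP t D.
    rewrite (le_trans st tD); apply: le_trans (fl _ _ _ _) _.
    - by rewrite s0 (le_trans st).
    - by rewrite tD (le_trans s0).
    - by rewrite distrC ger0_norm ?subr_ge0.
  have [sD|sD] := leP s D.
    have h1 : mdist (f s) (f D) <= D - s.
      apply: le_trans (fl _ _ _ _) _; rewrite ?s0 ?lexx ?D0//.
      by rewrite distrC ger0_norm// subr_ge0.
    have h2 : mdist (g 0) (g (t - D)) <= t - D.
      apply: le_trans (gl _ _ _ _) _; first by rewrite lexx E0.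
        by rewrite subr_ge0 (ltW tD) lerBlDl.
      by rewrite sub0r normrN ger0_norm// subr_ge0 ltW.
    have := metric_triangle (f s) (f D) (g (t - D)).
    by rewrite {2}fD -g0; lra.
  apply: le_trans (gl _ _ _ _) _.
  - by apply/andP; split; lra.
  - by apply/andP; split; lra.
  - by rewrite distrC ger0_norm; lra.
exists h; split.
- by rewrite /h D0.
- rewrite /h; case: leP => [DE|_]; last by rewrite addrC addKr.
  have E00 : E = 0 by lra.
  by rewrite E00 addr0 fD -g0 -gE E00.
- move=> s t /andP[s0 sD] /andP[t0 tD]; have [st|ts] := leP s t.
    by rewrite distrC ger0_norm ?subr_ge0//; exact: hl.
  have ts' := ltW ts; rewrite metric_sym ger0_norm ?subr_ge0//.
  exact: hl.
Qed.

Lemma geodesic_path x y D : geodesic x y D ->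
  exists2 g, is_path x y g & (path_length g <= D%:E)%E.
Proof.
move=> [D0 [f [f0 fD fl]]]; pose g t := f (D * t).
have gl (s t : R) : 0 <= s <= 1 -> 0 <= t <= 1 ->
    mdist (g s) (g t) <= D * `|s - t|.
  move=> /andP[s0 s1] /andP[t0 t1].
  have -> : D * `|s - t| = `|D * s - D * t|.
    by rewrite -mulrBr normrM (ger0_norm D0).
  by apply: fl; rewrite mulr_ge0//= ler_piMr.
exists g; last exact: path_length_lipschitz.
split; rewrite /g ?mulr0 ?mulr1//.
apply: (@lipschitz_within_continuous _ D) => //.
Qed.

Lemma geodesic_connected (x : X) :
  (forall y, exists D, geodesic x y D) -> connected [set: X].
Proof.
move=> geo; have gP y : exists g : R -> X, is_path x y g.
  by have [D /geodesic_path[g gp _]] := geo y; exists g.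
have -> : [set: X] = \bigcup_(y in [set: X]) (sval (cid (gP y)) @` `[0, 1]).
  apply/seteqP; split=> // y _; exists y => //; case: cid => g [_ _ g1] /=.
  by exists 1; rewrite ?g1//= in_itv/= ler01 lexx.
apply: bigcup_connected.
  exists x => y _; case: cid => g [_ g0 _] /=.
  by exists 0; rewrite ?g0//= in_itv/= ler01 lexx.
move=> y _; case: cid => g [gc _ _] /=; apply: connected_continuous_connected gc.
exact/connected_intervalP/interval_is_interval.
Qed.

Lemma length_space_geodesic :
  (forall x y : X, geodesic x y (mdist x y)) -> length_space X.
Proof.
move=> geo x y; apply/eqP; rewrite eq_le; apply/andP; split.
  apply: le_ereal_inf_tmp => _ [g [_ g0 g1] <-].
  have := @path_length_ge g 0; rewrite lexx ler01 mdistxx add0r g0 g1.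
  exact.
have [g gp gl] := geodesic_path (geo x y).
by apply: le_trans gl; apply: ereal_inf_lbound; exists g.
Qed.

End MetricPaths.

(** * The necklace and its distance *)

Section Necklace.
Context (R : realType) (c : nat).

Definition circ : R := c.+1%:R^-1.

Lemma circ_gt0 : 0 < circ. Proof. by rewrite invr_gt0. Qed.

(** The circles of the necklace are attached at the integers of the spine. *)
Definition post (u : R) : bool := [exists j : 'I_c.+1, u == j%:R].

Lemma postP u : reflect (exists j : 'I_c.+1, u = j%:R) (post u).
Proof.
by apply: (iffP existsP) => -[j uj]; exists j; [exact/eqP | rewrite uj].
Qed.

Lemma post_nat (j : 'I_c.+1) : post j%:R. Proof. by apply/postP; exists j. Qed.

(** This gap is what makes the projection [npt] locally Lipschitz: two nearby
    points of the tree outside the spine lie on the same line. *)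
Lemma post_sep u v : post u -> post v -> u != v -> 1 <= `|u - v|.
Proof.
move=> /postP[i ->] /postP[j ->] ij.
rewrite -[i%:R]/(i%:Z%:~R) -[j%:R]/(j%:Z%:~R) -rmorphB -intr_norm.
rewrite -[1]/(1%:~R) ler_int -gtz0_ge1 normr_gt0 subr_eq0.
by apply: contra ij => /eqP[->].
Qed.

(** The unrolled necklace: each circle is replaced by a whole line attached at
    its post. It covers the necklace through [npt] below, and it is
    contractible. *)
Definition in_tree (p : R * R) : bool :=
  (0 <= p.1 <= c%:R) && ((p.2 == 0) || post p.1).

Definition in_necklace (p : R * R) : bool :=
  in_tree p && (- (circ / 2) < p.2 <= circ / 2).

(** The point with position [u] on the spine and signed arc length [s] along
    the circle attached at [u]. Choosing [s] between [- l / 2] and [l / 2]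
    makes [|s|] the distance to the spine, and [s = l / 2] is the antipode of
    the attaching point. *)
Definition necklace : Type := {p : R * R | in_necklace p}.

HB.instance Definition _ := Choice.copy necklace {p : R * R | in_necklace p}.

Definition pos (x : necklace) : R := (val x).1.
Definition ang (x : necklace) : R := (val x).2.

Lemma necklaceP x : [/\ 0 <= pos x <= c%:R, ang x != 0 -> post (pos x) &
  - (circ / 2) < ang x <= circ / 2].
Proof.
have /andP[/andP[h1 h2] h3] := valP x; split=> //.
by case/orP: h2 => [/eqP|//]; rewrite /ang => ->; rewrite eqxx.
Qed.

Lemma necklace_eq x y : pos x = pos y -> ang x = ang y -> x = y.
Proof.
move=> h1 h2; apply: val_inj.
by rewrite [LHS]surjective_pairing [RHS]surjective_pairing; congr pair.
Qed.

Lemma cmod_ang x : cmod circ (ang x) = ang x.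
Proof. by have [_ _ h] := necklaceP x; rewrite cmod_id ?circ_gt0. Qed.

Lemma cnorm_ang x : cnorm circ (ang x) = `|ang x|.
Proof. by rewrite /cnorm cmod_ang. Qed.

Definition ndist (x y : necklace) : R :=
  if pos x == pos y then cnorm circ (ang x - ang y)
  else `|pos x - pos y| + `|ang x| + `|ang y|.

Lemma ndistxx x : ndist x x = 0.
Proof. by rewrite /ndist eqxx subrr cnorm0 ?circ_gt0. Qed.

Lemma ndist_pos x y : ndist x y = 0 -> x = y.
Proof.
rewrite /ndist; case: eqVneq => [pxy /(cnormB_eq0 circ_gt0)|pxy].
  by rewrite !cmod_ang; exact: necklace_eq.
have : 0 < `|pos x - pos y| by rewrite normr_gt0 subr_eq0.
by have := normr_ge0 (ang x); have := normr_ge0 (ang y) => *; exfalso; lra.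
Qed.

Lemma ndist_sym x y : ndist x y = ndist y x.
Proof.
rewrite /ndist eq_sym; case: eqVneq => _.
  by rewrite -cnormN ?circ_gt0// opprB.
by rewrite distrC addrAC.
Qed.

Lemma ndist_triangle y x z : ndist x z <= ndist x y + ndist y z.
Proof.
have c0 := circ_gt0.
have sub a b : `|ang a| <= cnorm circ (ang a - ang b) + `|ang b|.
  by have := cnormD c0 (ang a - ang b) (ang b); rewrite subrK !cnorm_ang.
have sub' a b : `|ang a| <= cnorm circ (ang b - ang a) + `|ang b|.
  by rewrite -[X in cnorm _ X]opprB cnormN.
rewrite /ndist; have [xz|xz] := eqVneq (pos x) (pos z).
  have [xy|xy] := eqVneq (pos x) (pos y).
    have := cnormD c0 (ang x - ang y) (ang y - ang z).
    by rewrite -xy xz eqxx addrA subrK.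
  rewrite eq_sym -xz (negbTE xy).
  have := cnormD c0 (ang x) (- ang z); rewrite cnormN // !cnorm_ang.
  by have := normr_ge0 (pos x - pos y); have := normr_ge0 (pos y - pos x);
    have := normr_ge0 (ang y); lra.
have [xy|xy] := eqVneq (pos x) (pos y).
  by rewrite -xy (negbTE xz); have := sub x y; lra.
have [yz|yz] := eqVneq (pos y) (pos z).
  by rewrite yz; have := sub' z y; lra.
have := ler_distD (pos y) (pos x) (pos z).
by have := normr_ge0 (ang y); lra.
Qed.

HB.instance Definition _ := isMetric.Build R necklace
  ndistxx ndist_pos ndist_sym ndist_triangle.

Lemma mdistE (x y : necklace) : mdist x y = ndist x y. Proof. by []. Qed.

Lemma base_in_necklace : in_necklace (0, 0).
Proof.
by rewrite /in_necklace /in_tree/= lexx ler0n eqxx oppr_lt0 divr_gt0 ?circ_gt0//=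
  divr_ge0 ?ltW ?circ_gt0.
Qed.

Definition base : necklace := exist _ (0, 0) base_in_necklace.

(** The projection of the tree to the necklace. It is meaningful on [in_tree]
    only; the default value makes it total. *)
Definition npt (u s : R) : necklace := insubd base (u, cmod circ s).

Lemma cmod_in_tree u s : in_tree (u, s) -> in_necklace (u, cmod circ s).
Proof.
rewrite /in_necklace cmod_itv ?circ_gt0 // andbT /in_tree /=.
move=> /andP[-> /orP[/eqP->|->]]; last by rewrite orbT.
by rewrite cmod0 ?circ_gt0 ?eqxx.
Qed.

Lemma pos_npt u s : in_tree (u, s) -> pos (npt u s) = u.
Proof. by move=> h; rewrite /pos /npt val_insubd cmod_in_tree. Qed.

Lemma ang_npt u s : in_tree (u, s) -> ang (npt u s) = cmod circ s.
Proof. by move=> h; rewrite /ang /npt val_insubd cmod_in_tree. Qed.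

Lemma necklace_in_tree x : in_tree (pos x, ang x).
Proof. by have /andP[h _] := valP x; rewrite -surjective_pairing. Qed.

Lemma npt_pos_ang x : npt (pos x) (ang x) = x.
Proof.
have t := necklace_in_tree x.
by apply: necklace_eq; rewrite ?pos_npt ?ang_npt ?cmod_ang.
Qed.

Lemma nptDl (k : int) u s : npt u (s + k%:~R * circ) = npt u s.
Proof. by rewrite /npt cmodDl ?circ_gt0. Qed.

Lemma in_tree0 u : 0 <= u <= c%:R -> in_tree (u, 0).
Proof. by rewrite /in_tree /= eqxx => ->. Qed.

Lemma in_tree_post (j : 'I_c.+1) s : in_tree (j%:R, s).
Proof. by rewrite /in_tree/= post_nat orbT ler0n ler_nat -ltnS ltn_ord. Qed.

Lemma ndist_npt u s v t : in_tree (u, s) -> in_tree (v, t) ->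
  ndist (npt u s) (npt v t) = if u == v then cnorm circ (s - t)
    else `|u - v| + cnorm circ s + cnorm circ t.
Proof.
by move=> h h'; rewrite /ndist !pos_npt// !ang_npt// cnormB_cmod ?circ_gt0.
Qed.

(** If the positions differ by less than [1], then they agree or one of the
    two points is on the spine. *)
Lemma ndist_npt_le u s v t : in_tree (u, s) -> in_tree (v, t) ->
  `|u - v| < 1 -> ndist (npt u s) (npt v t) <= `|u - v| + `|s - t|.
Proof.
move=> h h' uv; rewrite ndist_npt//; have [->|nuv] := eqVneq u v.
  by rewrite subrr normr0 add0r cnorm_le ?circ_gt0.
have c0 := circ_gt0; have := cnorm_le c0 s; have := cnorm_le c0 t.
have /orP[/eqP->|/eqP->] : (s == 0) || (t == 0).
- move: h h' => /andP[_ /= /orP[->//|pu]] /andP[_ /= /orP[->|pv]].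
    by rewrite orbT.
  by move: uv; rewrite ltNge post_sep.
- by rewrite normr0 add0r normrN; have := cnorm_ge0 circ 0; lra.
- by rewrite normr0 subr0; have := cnorm_ge0 circ 0; lra.
Qed.

Lemma pos_dist x y : `|pos x - pos y| <= ndist x y.
Proof.
rewrite /ndist; case: eqVneq => [->|_]; first by rewrite subrr normr0 cnorm_ge0.
by rewrite -addrA lerDl addr_ge0.
Qed.

(** If the positions differ, the way from [x] to [y] passes through the spine,
    and the circle norm of the difference is at most [|ang x| + |ang y|]. *)
Lemma ang_dist x y : cnorm circ (ang x - ang y) <= ndist x y.
Proof.
rewrite /ndist; case: eqVneq => // _.
apply: le_trans (cnorm_le circ_gt0 _) _; apply: le_trans (ler_normB _ _) _.
by rewrite lerD2r lerDr.
Qed.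

End Necklace.

(** * The necklace is a connected length space *)
Section NecklaceGeodesics.
Context (R : realType) (c : nat).
Local Notation N := (necklace R c).
Local Notation l := (circ R c).

Lemma geodesic_spine u v : 0 <= u <= c%:R -> 0 <= v <= c%:R ->
  geodesic (npt c u 0 : N) (npt c v 0) `|u - v|.
Proof.
wlog uv : u v / u <= v => [hw hu hv|/andP[u0 uc] /andP[v0 vc]].
  have [uv|/ltW vu] := leP u v; first exact: hw.
  by apply: geodesic_sym; rewrite distrC; exact: hw.
rewrite distrC ger0_norm ?subr_ge0//; split; first by rewrite subr_ge0.
exists (fun t => npt c (u + t) 0); split; rewrite ?addr0 ?(addrC u) ?subrK//.
move=> s t /andP[s0 s1] /andP[t0 t1]; rewrite mdistE ndist_npt.
- case: eqVneq => _; rewrite ?subrr cnorm0 ?circ_gt0//.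
  by rewrite !addr0 opprD addrACA subrr add0r.
- by apply: in_tree0; apply/andP; split; lra.
- by apply: in_tree0; apply/andP; split; lra.
Qed.

(** On a circle every arc is unit speed; the arc need not be the shorter one,
    and the choice of the lifts [s] and [t] decides which one is taken. *)
Lemma geodesic_circle u s t : 0 <= u <= c%:R -> s = t \/ post c u ->
  geodesic (npt c u s : N) (npt c u t) `|s - t|.
Proof.
move=> uc [->|pu].
  rewrite subrr normr0; split=> //; exists (fun=> npt c u t).
  by split=> // *; rewrite mdistE ndistxx normr_ge0.
have ut x : in_tree c (u, x) by rewrite /in_tree /= uc pu orbT.
wlog st : s t / s <= t => [hw|].
  have [st|/ltW ts] := leP s t; first exact: hw.
  by apply: geodesic_sym; rewrite distrC; exact: hw.
rewrite distrC ger0_norm ?subr_ge0//; split; first by rewrite subr_ge0.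
exists (fun x => npt c u (s + x)); split; rewrite ?addr0 ?(addrC s) ?subrK//.
move=> x y _ _; rewrite mdistE ndist_npt// eqxx.
rewrite opprD addrACA subrr add0r.
exact/cnorm_le/circ_gt0.
Qed.

(** On a common circle the shorter arc is obtained by shifting one end point
    by the multiple of [l] that realizes the circle norm; otherwise one goes
    down to the spine, along it, and up again. *)
Lemma necklace_geodesic (x y : N) : geodesic x y (mdist x y).
Proof.
rewrite mdistE.
have [x1 x2 _] := necklaceP x; have [y1 y2 _] := necklaceP y.
rewrite /ndist -{1}(npt_pos_ang x) -{1}(npt_pos_ang y).
have [xy|xy] := eqVneq (pos x) (pos y).
  set k := Num.ceil ((ang x - ang y) / l - 2^-1).
  have -> : cnorm l (ang x - ang y) = `|ang x - (ang y + k%:~R * l)|.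
    by rewrite /cnorm /cmod -/k opprD addrA.
  rewrite -xy -[npt c (pos x) (ang y)](nptDl _ k); apply: geodesic_circle => //.
  have [ax|/x2] := eqVneq (ang x) 0; last by right.
  have [ay|/y2] := eqVneq (ang y) 0; last by rewrite -xy; right.
  left; rewrite /k ax ay subrr mul0r sub0r.
  by rewrite (_ : Num.ceil _ = 0) ?mul0r ?addr0//; apply: ceil_def; lra.
have gx (z : N) : geodesic (npt c (pos z) (ang z)) (npt c (pos z) 0) `|ang z|.
  have [z1 z2 _] := necklaceP z.
  rewrite -[X in geodesic _ _ `|X|]subr0; apply: geodesic_circle => //.
  by have [->|/z2] := eqVneq (ang z) 0; [left|right].
rewrite -addrA addrCA; apply: geodesic_trans (gx x) _.
apply: geodesic_trans (geodesic_spine x1 y1) _; exact/geodesic_sym/gx.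
Qed.

Lemma necklace_length_space : length_space N.
Proof. exact/length_space_geodesic/necklace_geodesic. Qed.

Lemma necklace_connected : connected [set: N].
Proof.
apply: (@geodesic_connected _ _ (base R c)) => y.
by exists (mdist (base R c) y); exact: necklace_geodesic.
Qed.

End NecklaceGeodesics.

(** * The graph structure and its Betti number *)

Section NecklaceGraph.
Context (R : realType) (c : nat).
Local Notation N := (necklace R c).
Local Notation l := (circ R c).

Lemma npt_continuous (U : pseudoMetricType R) (A : set U) (a s : U -> R) :
  {within A, continuous a} -> {within A, continuous s} ->
  (forall y, A y -> in_tree c (a y, s y)) ->
  {within A, continuous (fun y => npt c (a y) (s y) : N)}.
Proof.
move=> /(@within_continuousE R R^o _ A a) ca.
move=> /(@within_continuousE R R^o _ A s) cs As.
apply/within_continuousE => x Ax e e0.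
have e1 : 0 < Num.min 1 (e / 2) by rewrite lt_min ltr01 divr_gt0.
have [d1 d10 h1] := ca x Ax _ e1; have [d2 d20 h2] := cs x Ax _ e1.
exists (Num.min d1 d2) => [|y Ay xy]; first by rewrite lt_min d10.
have b1 : `|a y - a x| < Num.min 1 (e / 2).
  by apply: h1 => //; apply: le_ball xy; rewrite ge_min lexx.
have b2 : `|s y - s x| < Num.min 1 (e / 2).
  by apply: h2 => //; apply: le_ball xy; rewrite ge_min lexx orbT.
move: b1 b2; rewrite !lt_min => /andP[b1 b1'] /andP[_ b2].
rewrite mdistE; apply: le_lt_trans (ndist_npt_le (As x Ax) (As y Ay) _) _.
  by rewrite distrC.
by rewrite distrC [X in _ + X]distrC; lra.
Qed.

Lemma nat_dist_lt1 (i j : nat) : `|i%:R - j%:R| < 1 :> R -> i = j.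
Proof.
rewrite -[i%:R]/(i%:Z%:~R) -[j%:R]/(j%:Z%:~R) -rmorphB -intr_norm.
rewrite -[1]/(1%:~R) ltr_int -[1]add0r ltzD1 normr_le0 subr_eq0.
by move/eqP => [].
Qed.

Lemma int_dist_lt1 (k : int) : `|k%:~R| < 1 :> R -> k = 0.
Proof.
by rewrite -intr_norm -[1]/(1%:~R) ltr_int -[1]add0r ltzD1 normr_le0 => /eqP.
Qed.

Definition nvertex (j : 'I_c.+1) : N := npt c j%:R 0.

Definition nedge (e : 'I_c + 'I_c.+1) (t : R) : N :=
  match e with
  | inl i => npt c (i%:R + t) 0
  | inr j => npt c j%:R (t * l)
  end.

Lemma in_tree_vertex (j : 'I_c.+1) : in_tree c (j%:R : R, 0).
Proof. exact: in_tree_post. Qed.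

Lemma in_tree_spine (i : 'I_c) (t : R) : 0 <= t <= 1 -> in_tree c (i%:R + t, 0).
Proof.
move=> /andP[t0 t1]; apply: in_tree0; rewrite addr_ge0//=.
have : (i.+1%:R : R) <= c%:R by rewrite ler_nat.
by rewrite -natr1; lra.
Qed.

Lemma nvertex_inj : injective nvertex.
Proof.
move=> i j /(congr1 (@pos R c)); rewrite !pos_npt ?in_tree_vertex// => /eqP.
by rewrite eqr_nat => /eqP/val_inj.
Qed.

Lemma nedge_continuous e : {within `[0, 1], continuous (nedge e)}.
Proof.
case: e => [i|j]; apply: (@npt_continuous _ _ _ _) => //.
- by apply: continuous_subspaceT => t; apply: cvgD => //; exact: cvg_cst.
- by apply: continuous_subspaceT => t; exact: cvg_cst.
- by move=> t; rewrite /= in_itv/=; exact: in_tree_spine.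
- by apply: continuous_subspaceT => t; exact: cvg_cst.
- by apply: continuous_subspaceT => t; apply: cvgM => //; exact: cvg_cst.
- by move=> t _; exact: in_tree_post.
Qed.

Lemma nedge0 e : range nvertex (nedge e 0).
Proof.
case: e => [i|j] /=; last by exists j => //; rewrite mul0r.
by exists (widen_ord (leqnSn _) i) => //; rewrite addr0.
Qed.

Lemma nedge1 e : range nvertex (nedge e 1).
Proof.
case: e => [i|j] /=.
  by exists (lift ord0 i) => //; rewrite /nvertex lift0 natr1.
by exists j => //; rewrite /nvertex -[1 * l]add0r (nptDl _ 1).
Qed.

Lemma spine_post_neq (i : 'I_c) (j : 'I_c.+1) (s : R) :
  0 < s < 1 -> i%:R + s <> j%:R.
Proof.
move=> /andP[s0 s1] sij; have ij : (i : nat) = j.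
  by apply: nat_dist_lt1; rewrite -sij opprD addrA subrr sub0r normrN gtr0_norm.
by move: sij; rewrite ij; lra.
Qed.

Lemma circle_inj (s t : R) : 0 < s < 1 -> 0 <= t < 1 ->
  cmod l (s * l) = cmod l (t * l) -> s = t.
Proof.
move=> /andP[s0 s1] /andP[t0 t1] /cmod_eq[k].
rewrite -mulrDl => /mulIf; rewrite gt_eqF ?circ_gt0// => /(_ isT) stk.
by rewrite stk (@int_dist_lt1 k) ?addr0// ltr_norml; apply/andP; split; lra.
Qed.

Lemma nedge_inj e e' (s t : R) : s \in `]0, 1[ -> t \in `]0, 1[ ->
  nedge e s = nedge e' t -> e = e' /\ s = t.
Proof.
rewrite !in_itv/= => s01 t01.
have w (x : R) : 0 < x < 1 -> 0 <= x <= 1 by case/andP => /ltW-> /ltW->.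
case: e e' => [i|j] [i'|j'] /= st; have := congr1 (@pos R c) st;
  rewrite !pos_npt ?in_tree_post ?in_tree_spine ?w//.
- move=> ist; have ii : i = i'.
    apply: val_inj; apply: nat_dist_lt1; rewrite ltr_norml.
    by case/andP: s01 => ? ?; case/andP: t01 => ? ?; apply/andP; split; lra.
  by split; [rewrite ii | move: ist; rewrite ii => /addrI].
- by move/spine_post_neq => /(_ s01).
- by move/esym/spine_post_neq => /(_ t01).
- move/eqP; rewrite eqr_nat => /eqP/val_inj jj; split; first by rewrite jj.
  have := congr1 (@ang R c) st; rewrite !ang_npt ?in_tree_post//.
  by apply: circle_inj => //; case/andP: t01 => /ltW -> ->.
Qed.

Lemma nedge_vertex e (s : R) : s \in `]0, 1[ -> ~ range nvertex (nedge e s).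
Proof.
rewrite in_itv/= => s01; have /andP[s0 s1] := s01.
case: e => [i|j] /= [j' _ js].
  have := congr1 (@pos R c) js.
  rewrite !pos_npt ?in_tree_vertex ?in_tree_spine ?(ltW s0) ?(ltW s1)//.
  by move/esym/spine_post_neq => /(_ s01).
have := congr1 (@ang R c) js; rewrite !ang_npt ?in_tree_vertex ?in_tree_post//.
rewrite -(mul0r l) => /esym/circle_inj; rewrite lexx ltr01 s01 => /(_ isT isT).
by move=> se; rewrite se ltxx in s0.
Qed.

Lemma nedge_cover (x : N) : range nvertex x \/
  exists e, exists2 s : R, s \in `]0, 1[ & nedge e s = x.
Proof.
have [/andP[u0 uc] ux /andP[a1 a2]] := necklaceP x.
have l0 := circ_gt0 R c.
have [a0|an0] := eqVneq (ang x) 0; last first.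
  right; have /postP[j uj] := ux an0; exists (inr j).
  have [ap|an] := ltP 0 (ang x).
    exists (ang x / l); last by rewrite /= divfK ?gt_eqF// -uj npt_pos_ang.
    by rewrite in_itv/= divr_gt0// ltr_pdivrMr// mul1r; lra.
  have an' : ang x < 0 by rewrite lt_neqAle an0.
  exists ((ang x + l) / l).
    by rewrite in_itv/= ltr_pdivrMr// mul1r ltr_pdivlMr// mul0r; apply/andP; lra.
  by rewrite /= divfK ?gt_eqF// -uj -[l in ang x + l]mul1r (nptDl _ 1) npt_pos_ang.
have [/postP[j uj]|np] := boolP (post c (pos x)).
  by left; exists j => //; rewrite /nvertex -uj -a0 npt_pos_ang.
right; set i := Num.truncn (pos x).
have /andP[i1 i2] : i%:R <= pos x < i.+1%:R by exact: truncn_itv.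
have ic : (i < c.+1)%N by rewrite ltnS -(ler_nat R); exact: le_trans i1 uc.
have iu : i%:R < pos x.
  rewrite lt_neqAle i1 andbT; apply: contra np => /eqP <-.
  exact: (post_nat _ (Ordinal ic)).
have ic' : (i < c)%N by rewrite -(ltr_nat R); exact: lt_le_trans iu uc.
exists (inl (Ordinal ic')), (pos x - i%:R).
  by rewrite in_itv/= subr_gt0 iu ltrBlDl natr1.
by rewrite /= addrC subrK -a0 npt_pos_ang.
Qed.

Definition necklace_graph : graph_structure R N :=
  GraphStructure nvertex_inj nedge_continuous nedge0 nedge1 nedge_inj
    nedge_vertex nedge_cover.

Lemma betti1_necklace : betti1 necklace_graph = c.+1%:Z.
Proof.
rewrite /betti1 /= card_sum !card_ord.
have -> : [set connected_component [set: N] x | x in [set: N]] = [set [set: N]].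
  have cc (x : N) : connected_component [set: N] x = [set: N].
    by apply: connected_component_id => //; exact: necklace_connected.
  apply/seteqP; split=> [_ [x _ <-]|_ ->] /=; first exact: cc.
  by exists (base R c) => //; exact: cc.
by rewrite fset_set1 cardfs1 PoszD addrK -PoszD addn1.
Qed.

Definition necklace_mg : metricGraph R :=
  MetricGraph necklace_graph (@necklace_length_space R c).

End NecklaceGraph.

(** * Diameters, and covers of an interval *)

Section Diameter.
Context (R : realType) (X : metricType R).
Local Open Scope ereal_scope.

Lemma diameter_ge0 (A : set X) : 0 <= diameter A.
Proof. by apply: ereal_sup_ubound; left. Qed.

Lemma diameter_ubound (A : set X) x y : A x -> A y ->
  (mdist x y)%:E <= diameter A.
Proof. by move=> Ax Ay; apply: ereal_sup_ubound; right; exists (x, y). Qed.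

Lemma diameter_le (A : set X) (r : R) : (0 <= r)%R ->
  (forall x y, A x -> A y -> (mdist x y <= r)%R) -> diameter A <= r%:E.
Proof.
move=> r0 Ar; apply: ge_ereal_sup => _ [->|[[x y] [/= Ax Ay] <-]].
  by rewrite lee_fin.
by rewrite lee_fin Ar.
Qed.

End Diameter.

Section Covering.
Context (R : realType).
Local Open Scope ereal_scope.

(** Countable subadditivity of the Lebesgue measure; the [K] intervals around
    the points [z k] account for the part of [0, b] that the [i]-indexed
    intervals are allowed to miss. *)
Lemma cover_length (b eta : R) (K : nat) (z a r : nat -> R) : (0 <= b)%R ->
  (0 <= eta)%R -> (forall i, 0 <= r i)%R ->
  (forall y : R, 0 <= y <= b -> (exists2 k, (k < K)%N & `|y - z k| < eta) \/
                          exists i, a i <= y <= a i + r i)%R ->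
  b%:E <= (K%:R * (2 * eta))%:E + \sum_(0 <= i <oo) (r i)%:E.
Proof.
move=> b0 eta0 r0 cov.
pose mu := @lebesgue_measure R.
pose B i : set R := `[(z i - eta)%R, (z i + eta)%R]%classic.
pose C i : set R := `[a i, (a i + r i)%R]%classic.
have mI (x y : R) : (x <= y)%R -> mu `[x, y]%classic = (y - x)%:E.
  move=> xy; rewrite /mu lebesgue_measure_itv /= lte_fin.
  move: xy; rewrite le_eqVlt => /orP[/eqP ->|xy]; last by rewrite xy EFinB.
  by rewrite ltxx subrr.
have mC : measurable (\bigcup_i C i : set R).
  by apply: bigcupT_measurable => i; exact: measurable_itv.
have mB : measurable (\big[setU/set0]_(i < K) B i : set R).
  by apply: bigsetU_measurable => i _; exact: measurable_itv.
have -> : b%:E = mu `[0%R, b]%classic by rewrite mI// subr0.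
apply: (@le_trans _ _ (mu ((\big[setU/set0]_(i < K) B i) `|` \bigcup_i C i))).
  apply: le_measure; rewrite ?inE//; first exact: measurableU.
  move=> y /=; rewrite in_itv/= => /cov[[k kK yk]|[i yi]].
    left; rewrite -bigcup_mkord; exists k => //=; rewrite /B/= in_itv/=.
    by move: yk; rewrite ltr_norml => /andP[? ?]; apply/andP; split; lra.
  by right; exists i => //=; rewrite /C/= in_itv.
apply: (@le_trans _ _ (mu (\big[setU/set0]_(i < K) B i) + mu (\bigcup_i C i))).
  exact: measureU2.
apply: leeD.
  apply: (@le_trans _ _ (\sum_(i < K) mu (B i))).
    by apply: Boole_inequality => i _; exact: measurable_itv.
  rewrite (eq_bigr (fun=> (2 * eta)%:E)) => [|i _].
    by rewrite sumEFin sumr_const card_ord -[X in X%:E <= _]mulr_natl.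
  by rewrite /B mI; [congr EFin; lra | lra].
apply: (@le_trans _ _ (\sum_(0 <= i <oo) mu (C i))).
  by apply: generalized_Boole_inequality => // i; exact: measurable_itv.
apply: lee_nneseries => [i _ _|i _]; first exact: measure_ge0.
by rewrite /C mI ?lerDl// addrAC subrr add0r.
Qed.

Lemma diam_sub_itv (A : set R) (r : R) : (0 <= r)%R ->
  (forall x y, A x -> A y -> `|x - y| <= r)%R ->
  exists a : R, forall x, A x -> (a <= x <= a + r)%R.
Proof.
move=> r0 Ar; have [[x0 Ax0]|A0] := pselect (exists x, A x); last first.
  by exists 0%R => x Ax; case: A0; exists x.
have lbA x : A x -> lbound A (x - r)%R.
  move=> Ax y Ay; have := Ar _ _ Ax Ay; rewrite ler_norml => /andP[_ ?].
  by rewrite lerBlDr addrC -lerBlDr.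
exists (inf A) => x Ax; apply/andP; split.
  by apply: ge_inf => //; exists (x0 - r)%R; exact: lbA.
by rewrite -lerBlDr; apply: lb_le_inf; [exists x0 | exact: lbA].
Qed.

End Covering.

(** * The Hausdorff measure of the necklace *)
Section NecklaceLength.
Context (R : realType) (c : nat).
Local Notation N := (necklace R c).
Local Notation l := (circ R c).
Local Notation b := c.+1.

Lemma circM : b%:R * l = 1 :> R. Proof. by rewrite mulfV// pnatr_eq0. Qed.

Lemma cnorm_big (x : R) : `|x| <= l ->
  `|x| <= cnorm l x \/ l - `|x| <= cnorm l x.
Proof.
have l0 := circ_gt0 R c => xl.
have h (k : int) : cmod l x = x - k%:~R * l ->
    `|x| <= cnorm l x \/ l - `|x| <= cnorm l x.
  rewrite /cnorm => ->; have [->|k0] := eqVneq k 0.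
    by left; rewrite mul0r subr0.
  right; have : 1 <= `|k%:~R| :> R.
    by rewrite -intr_norm -[1]/(1%:~R) ler_int -gtz0_ge1 normr_gt0.
  rewrite -(ler_pM2r l0) mul1r -{2}(gtr0_norm l0) -normrM => kl.
  have := ler_normB (x - k%:~R * l) x.
  by rewrite addrAC subrr add0r normrN; lra.
exact: (h (Num.ceil (x / l - 2^-1))).
Qed.

(** The edges laid end to end: the spine first, then the circles one after the
    other, each cut open at its antipode. Only points at distance at least
    [eta] from the vertices and from the antipodes are related, so that nearby
    points are on a common edge and are not separated by a cut. *)
Definition unrolled (eta x : R) (p : N) : Prop :=
  (p = npt c x 0 /\ 0 <= x <= c%:R /\
     forall j : 'I_b, eta <= `|x - j%:R|) \/
  exists (j : 'I_b) (s : R), [/\ x = c%:R + j%:R * l + l / 2 + s,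
    p = npt c j%:R s & eta <= `|s| <= l / 2 - eta].

(** All vertices and antipodes are sent to multiples of [l / 2], so it suffices
    to stay [eta] away from the grid of these multiples in [0, b], which has
    [2 b^2 + 1] points. *)
Lemma unrolled_exists (eta x : R) : 0 < eta -> 0 <= x <= b%:R ->
  (forall k, (k < (2 * b * b).+1)%N -> eta <= `|x - k%:R * (l / 2)|) ->
  exists p, unrolled eta x p.
Proof.
move=> eta0 /andP[x0 xb] xk; have l0 := circ_gt0 R c.
have natpt (j : nat) : j%:R = (2 * b * j)%:R * (l / 2) :> R.
  rewrite !natrM -[LHS]mul1r -[X in X * _ = _]circM.
  by move: (c.+1%:R : R) l => B L; field.
have [xc|xc] := leP x c%:R.
  exists (npt c x 0); left; rewrite x0 xc; split=> //; split=> // j.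
  rewrite (natpt j); apply: xk.
  by rewrite ltnS leq_mul2l /= ltnW ?ltn_ord // orbT.
set y := x - c%:R; set j := Num.truncn (y / l).
have y0 : 0 < y by rewrite subr_gt0.
have yl : 0 <= y / l by rewrite divr_ge0 ?ltW.
have /andP[j1 j2] : j%:R <= y / l < j.+1%:R by exact: truncn_itv.
have {}j1 : j%:R * l <= y by rewrite -ler_pdivlMr.
have {}j2 : y < j.+1%:R * l by rewrite -ltr_pdivrMr.
have pt (k : nat) : (k <= 2 * b)%N -> eta <= `|y - k%:R * (l / 2)|.
  move=> kb; have := xk (2 * b * c + k)%N.
  rewrite natrD mulrDl -natpt opprD addrA; apply.
  by rewrite ltnS [leqRHS]mulnSr leq_add2l.
have jb : (j < b)%N.
  have : y != 1.
    apply/eqP => y1; have := pt _ (leqnn _).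
    have -> : (2 * b)%:R * (l / 2) = 1 :> R.
      by rewrite natrM -[RHS]circM; move: (c.+1%:R : R) l => B L; field.
    by rewrite y1 subrr normr0 leNgt eta0.
  have y1 : y <= 1 by rewrite /y lerBlDl natr1.
  move=> yn1; have : y < 1 by rewrite lt_neqAle yn1.
  rewrite -circM => /(le_lt_trans j1); rewrite ltr_pM2r// ltr_nat.
  done.
exists (npt c j%:R (y - j%:R * l - l / 2)); right.
exists (Ordinal jb), (y - j%:R * l - l / 2); split=> //.
  by rewrite /y /=; ring.
have h1 : eta <= `|y - j%:R * l|.
  have := pt (2 * j)%N; rewrite leq_mul2l /= (ltnW jb) => /(_ isT).
  by rewrite natrM (_ : _ * _ = j%:R * l)//; field.
have h2 : eta <= `|y - (j%:R + 1) * l|.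
  have := pt (2 * j.+1)%N; rewrite leq_mul2l /= jb => /(_ isT).
  by rewrite natrM -natr1 (_ : _ * _ = (j%:R + 1) * l)//; field.
have h3 : eta <= `|y - j%:R * l - l / 2|.
  have := pt (2 * j).+1; rewrite !mul2n ltn_double jb => /(_ isT).
  rewrite -mul2n -natr1 natrM (_ : _ * (l / 2) = j%:R * l + l / 2); last by field.
  by rewrite opprD addrA.
rewrite h3 /= ler_norml; move: h1 h2.
rewrite ger0_norm ?subr_ge0// ler0_norm ?subr_le0; last by rewrite natr1 ltW.
by move=> h1 h2; apply/andP; split; lra.
Qed.

(** Two points on different edges, both [eta] away from the vertices, have
    distance at least [eta]. On a common circle the arc through the antipode
    has length at least [2 eta]. *)
Lemma unrolled_dist (eta x y : R) (p q : N) : 0 < eta ->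
  unrolled eta x p -> unrolled eta y q -> mdist p q < eta ->
  `|x - y| <= mdist p q.
Proof.
move=> eta0; have l0 := circ_gt0 R c.
have mixed (x' s : R) (j : 'I_b) : 0 <= x' <= c%:R -> eta <= `|x' - j%:R| ->
    eta <= ndist (npt c x' 0) (npt c j%:R s).
  move=> hx hj; apply: le_trans (pos_dist _ _).
  by rewrite !pos_npt ?in_tree_post ?in_tree0.
rewrite mdistE.
case=> [[-> [hx xj]]|[i [s [-> -> /andP[s1 s2]]]]].
  case=> [[-> [hy yj]]|[j [t [-> -> /andP[t1 t2]]]]] => [_|].
    by have := pos_dist (npt c x 0) (npt c y 0); rewrite !pos_npt ?in_tree0.
  by rewrite ltNge mixed.
case=> [[-> [hy yj]]|[j [t [-> -> /andP[t1 t2]]]]].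
  by rewrite ndist_sym ltNge mixed.
have cn u : eta <= `|u| <= l / 2 - eta -> cnorm l u = `|u|.
  rewrite ler_norml => /andP[_ /andP[? ?]].
  by rewrite /cnorm cmod_id//; apply/andP; split; lra.
rewrite ndist_npt ?in_tree_post// eqr_nat; case: eqVneq => [/val_inj->|_].
  rewrite (_ : _ - _ = s - t); last by ring.
  have st : `|s - t| <= l - eta *+ 2 by rewrite mulr2n; have := ler_normB s t; lra.
  by have [//||] := @cnorm_big (s - t); rewrite mulr2n in st; lra.
by rewrite !cn ?s1 ?t1//; have := normr_ge0 (i%:R - j%:R : R); lra.
Qed.

(** The pieces of a fine cover, restricted to the part of the necklace away
    from the vertices and antipodes, unroll to subsets of the line whose
    diameters are no larger; together with intervals of length [2 eta] around
    the grid points they cover [0, b]. *)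
Lemma necklace_length_ge : (b%:R%:E <= hausdorff1 [set: N])%E.
Proof.
set K := (2 * b * b).+1.
have main (eta : R) : 0 < eta ->
    (b%:R%:E <= hausdorff1 [set: N] + (K%:R * (2 * eta))%:E)%E.
  move=> eta0; rewrite -leeBlDr//.
  apply: (@le_trans _ _ (hausdorff1_pre (eta / 2) [set: N])); last first.
    by apply: ereal_sup_ubound; exists (eta / 2) => //=; rewrite divr_gt0.
  apply: le_ereal_inf_tmp => _ [U [Ucov Ud] <-].
  have Ufin i : diameter (U i) \is a fin_num.
    by rewrite fin_numE -ltey -ltNye (lt_le_trans _ (diameter_ge0 _)) ?ltNyr//=
      (le_lt_trans (Ud i)) ?ltry.
  pose r i := fine (diameter (U i)).
  have rE i : diameter (U i) = (r i)%:E by rewrite fineK.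
  have r0 i : 0 <= r i by rewrite fine_ge0// diameter_ge0.
  pose A i : set R := [set x | exists2 p, U i p & unrolled eta x p].
  have Ar i x y : A i x -> A i y -> `|x - y| <= r i.
    move=> [p Up px] [q Uq qy].
    have pq : mdist p q <= r i by rewrite -lee_fin -rE diameter_ubound.
    apply: le_trans pq; apply: unrolled_dist px qy _ => //.
    apply: (@le_lt_trans _ _ (eta / 2)); last by lra.
    by rewrite -lee_fin; apply: le_trans (Ud i); exact: diameter_ubound.
  have /choice[a aP] i := diam_sub_itv (r0 i) (Ar i).
  rewrite leeBlDr// addeC (eq_eseriesr (fun i _ => rE i)).
  apply: (@cover_length _ _ _ _ (fun k => k%:R * (l / 2)) a r) => //.
    exact: ltW.
  move=> y yb.
  have [[k kK yk]|nk] := pselect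
    (exists2 k, (k < K)%N & `|y - k%:R * (l / 2)| < eta).
    by left; exists k.
  right; have [|p yp] := @unrolled_exists eta y eta0 yb.
    by move=> k kK; rewrite leNgt; apply/negP => yk; apply: nk; exists k.
  have [i _ Uip] := Ucov p I.
  by exists i; apply: aP; exists p.
apply/lee_addgt0Pr => e e0.
have K0 : 0 < K%:R * 2 :> R by rewrite mulr_gt0 ?ltr0n.
by have := main _ (divr_gt0 e0 K0); rewrite mulrA mulrC divfK// gt_eqF.
Qed.

(** The closed upper bounds [y <= m] and [t <= 1] let the last piece of an edge
    contain its end point. *)
Lemma nat_frac (m : nat) (y : R) : (0 < m)%N -> 0 <= y <= m%:R ->
  exists (i : nat) (t : R), [/\ (i < m)%N, 0 <= t <= 1 & y = i%:R + t].
Proof.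
move=> m0 /andP[y0]; rewrite le_eqVlt => /orP[/eqP->|ym].
  exists m.-1, 1; rewrite prednK// ler01 lexx natr1 prednK//.
exists (Num.truncn y), (y - (Num.truncn y)%:R).
have /andP[j1 j2] : (Num.truncn y)%:R <= y < (Num.truncn y).+1%:R.
  exact: truncn_itv.
rewrite -(ltr_nat R) (le_lt_trans j1)//; split=> //.
  by rewrite subr_ge0 j1 lerBlDl natr1 ltW.
by rewrite addrC subrK.
Qed.

(** Cut every edge into pieces of length [1 / M], with [M] a multiple of [b] so
    that circles are cut into a whole number [m] of pieces: there are [b M]
    pieces in total. *)
Lemma necklace_length_le : (hausdorff1 [set: N] <= b%:R%:E)%E.
Proof.
have l0 := circ_gt0 R c.
apply: ge_ereal_sup => _ [d /= d0 <-].
pose m := (Num.truncn d^-1).+1; pose M := (b * m)%N.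
have M0 : 0 < M%:R :> R by rewrite ltr0n.
have Md : M%:R^-1 <= d.
  rewrite invf_ple ?posrE//; apply: ltW; apply: lt_le_trans (truncnS_gt _) _.
  by rewrite ler_nat leq_pmull.
have lM : l = m%:R / M%:R.
  by rewrite /M natrM invfM mulrCA mulfV ?mulr1// pnatr_eq0.
(* The first [c M] pieces subdivide the spine, the next [M = b m] ones the
   circles, with [m] consecutive pieces on each. *)
pose f (k : nat) (t : R) : N := if (k < c * M)%N then npt c ((k%:R + t) / M%:R) 0
  else npt c ((k - c * M) %/ m)%:R
    (((k - c * M) %% m)%:R / M%:R + t / M%:R - l / 2).
pose U k : set N := if (k < b * M)%N then f k @` `[0, 1] else set0.
have fM k s t : (k < b * M)%N -> 0 <= s <= 1 -> 0 <= t <= 1 ->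
    mdist (f k s) (f k t) <= M%:R^-1.
  move=> kb /andP[s0 s1] /andP[t0 t1].
  have st : `|s - t| / M%:R <= M%:R^-1.
    by rewrite ler_piMl ?invr_ge0// ler_norml; apply/andP; split; lra.
  apply: le_trans st; rewrite -[M%:R in leRHS]gtr0_norm// -normfV -normrM mulrBl.
  rewrite mdistE /f; case: ltnP => kM.
    have tr (u : R) : 0 <= u -> u <= 1 -> in_tree c ((k%:R + u) / M%:R, 0).
      move=> u0 u1; apply: in_tree0; rewrite divr_ge0 ?addr_ge0 ?ler0n//=.
      rewrite ler_pdivrMr// -natrM.
      by apply: (@le_trans _ _ k.+1%:R); [rewrite -natr1 lerD2l|rewrite ler_nat].
    rewrite ndist_npt ?tr//; case: eqVneq => _.
      by rewrite subrr cnorm0.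
    by rewrite !cnorm0// !addr0 !mulrDl opprD addrACA subrr add0r.
  have jb : ((k - c * M) %/ m < b)%N.
    by rewrite ltn_divLR// ltn_subLR// -/M -mulSnr.
  have tr (u : R) : in_tree c (((k - c * M) %/ m)%:R, u).
    exact: in_tree_post (Ordinal jb) u.
  rewrite ndist_npt ?tr// eqxx.
  rewrite [X in cnorm _ X](_ : _ = s / M%:R - t / M%:R); last by ring.
  exact: cnorm_le.
apply: (@le_trans _ _ (\sum_(0 <= k <oo) diameter (U k))%E).
  apply: ereal_inf_lbound; exists U => //; split; last first.
    move=> k; rewrite /U; case: ifPn => kb.
      apply: diameter_le; first exact: ltW.
      move=> _ _ [s + <-] [t + <-]; rewrite /= !in_itv/= => s1 t1.
      by apply: le_trans Md; exact: fM.
    by apply: diameter_le => //; exact: ltW.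
  move=> p _; have [/andP[u0 uc] ux /andP[a1 a2]] := necklaceP p.
  have [/postP[j uj]|np] := boolP (post c (pos p)).
    have [|i [t [im t01 it]]] := @nat_frac m ((ang p + l / 2) * M%:R) isT.
      apply/andP; split; last by rewrite -ler_pdivlMr// -lM; lra.
      by apply: mulr_ge0; [lra | exact: ltW].
    exists (c * M + (j * m + i))%N => //.
    rewrite /U ifT; last first.
      rewrite mulSnr ltn_add2l; apply: (@leq_trans (j.+1 * m)).
        by rewrite mulSnr ltn_add2l.
      by rewrite leq_mul2r ltn_ord orbT.
    exists t; first by rewrite /= in_itv.
    rewrite /f ltnNge leq_addr /= addKn divnMDl// modnMDl divn_small// addn0.
    rewrite modn_small// -mulrDl -it mulfK ?gt_eqF// addrK.
    by rewrite -uj npt_pos_ang.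
  have c0 : (0 < c)%N.
    rewrite lt0n; apply: contra np => /eqP c0; apply/postP; exists ord0.
    by apply/eqP; rewrite eq_le u0 andbT (le_trans uc)//= ler_nat c0.
  have a0 : ang p = 0 by apply/eqP; apply: contraNT np => /ux.
  have [||i [t [im t01 it]]] := @nat_frac (c * M) (pos p * M%:R).
  - by rewrite muln_gt0 c0.
  - by rewrite mulr_ge0//= natrM ler_pM2r.
  exists i => //; rewrite /U ifT; last first.
    by rewrite (leq_trans im)// leq_mul2r leqnSn orbT.
  exists t; first by rewrite /= in_itv.
  by rewrite /f im -it mulfK ?gt_eqF// -a0 npt_pos_ang.
rewrite (nneseries_split 0 (b * M)); last by move=> *; exact: diameter_ge0.
rewrite add0n eseries0 ?adde0; last first.
  move=> k bk _; rewrite /U ltnNge bk /=; apply/eqP.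
  by rewrite eq_le diameter_ge0 andbT; apply: diameter_le.
apply: (@le_trans _ _ (\sum_(0 <= k < b * M) (M%:R^-1)%:E)%E).
  rewrite !big_nat; apply: lee_sum => k /andP[_ kb]; rewrite /U kb.
  apply: diameter_le; first by rewrite invr_ge0 ltW.
  by move=> _ _ [s + <-] [t + <-]; rewrite /= !in_itv/= => s1 t1; exact: fM.
rewrite sumEFin big_const_nat subn0 iter_addr_0 lee_fin.
by rewrite -[leLHS]mulr_natl natrM mulfK ?gt_eqF.
Qed.

Lemma necklace_length : hausdorff1 [set: N] = b%:R%:E.
Proof. by apply/eqP; rewrite eq_le necklace_length_le necklace_length_ge. Qed.

End NecklaceLength.

(** * Boundaries of singular chains *)

Section Boundaries.
Context (R : realType) (X : topologicalType).
Local Notation chain := ((R -> X) -> R).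
Local Notation bd := (@is_boundary R X).

Lemma is_boundary_ext (u v : chain) : (forall h, u h = v h) -> bd u -> bd v.
Proof.
move=> uv [n [a [f [fc ufE]]]]; exists n, a, f; split=> // h.
by rewrite -uv.
Qed.

Lemma is_boundary0 : bd (fun=> 0).
Proof.
have f (j : 'I_0) : R * R -> X by case: j.
exists 0%N, (fun=> 0), f; split=> [[]//|h].
by rewrite big_ord0.
Qed.

Lemma is_boundaryD (u v : chain) : bd u -> bd v -> bd (fun h => u h + v h).
Proof.
move=> [m [a [f [fc uE]]]] [n [a' [f' [fc' vE]]]].
exists (m + n)%N,
  (fun j => match fintype.split j with inl i => a i | inr i => a' i end),
  (fun j => match fintype.split j with inl i => f i | inr i => f' i end); split.
  by move=> j; case: fintype.split.
move=> h; rewrite big_split_ord uE vE; congr (_ + _); apply: eq_bigr => j _.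
  by rewrite (unsplitK (inl _ j)).
by rewrite (unsplitK (inr _ j)).
Qed.

Lemma is_boundaryZ (k : R) (u : chain) : bd u -> bd (fun h => k * u h).
Proof.
move=> [m [a [f [fc uE]]]]; exists m, (fun j => k * a j), f; split=> // h.
by rewrite uE mulr_sumr; apply: eq_bigr => j _; rewrite mulrA.
Qed.

Lemma is_boundaryB (u v : chain) : bd u -> bd v -> bd (fun h => u h - v h).
Proof.
move=> bu /(is_boundaryZ (-1)) bv.
by apply: is_boundary_ext (is_boundaryD bu bv) => h; rewrite mulN1r.
Qed.

Lemma is_boundary_sum (n : nat) (u : 'I_n -> chain) :
  (forall i, bd (u i)) -> bd (fun h => \sum_(i < n) u i h).
Proof.
elim: n u => [|n ih] u bu.
  by apply: is_boundary_ext is_boundary0 => h; rewrite big_ord0.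
apply: is_boundary_ext (is_boundaryD (ih _ (fun i => bu (widen_ord (leqnSn n) i)))
  (bu ord_max)) => h.
by rewrite big_ord_recr.
Qed.

Lemma is_boundary_triangle (f : R * R -> X) :
  {within @triangle R, continuous f} -> bd (boundary2 f).
Proof.
move=> fc; exists 1%N, (fun=> 1), (fun=> f); split=> // h.
by rewrite big_ord1 mul1r.
Qed.

Lemma simplex1_ext (g g' : R -> X) (h : R -> X) :
  (forall t, 0 <= t <= 1 -> g t = g' t) -> simplex1 g h = simplex1 g' h.
Proof.
move=> gg'; congr (nat_of_bool _)%:R; apply: asbool_equiv_eq.
by split=> gh t t01; have := gh t t01; rewrite gg' //; move: t01; rewrite in_itv.
Qed.

Lemma within_comp (U V : topologicalType) (A : set U) (B : set V)
    (f : U -> V) (g : V -> X) : {within A, continuous f} ->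
  (forall x, A x -> B (f x)) -> {within B, continuous g} ->
  {within A, continuous (g \o f)}.
Proof.
move=> /subspace_continuousP fc AB /subspace_continuousP gc.
apply/subspace_continuousP => x Ax W /(gc _ (AB _ Ax)) /(fc _ Ax) h.
have {}h : nbhs x [set z | A z -> B (f z) -> W (g (f z))] by [].
suff : nbhs x [set z | A z -> W (g (f z))] by [].
by apply: filterS h => z h Az; apply: h => //; exact: AB.
Qed.

Definition seg (g : R -> X) (a b t : R) : X := g (a + t * (b - a)).

Lemma affine_continuous (a b d : R) :
  continuous (fun p : R * R => a + p.1 * b + p.2 * d).
Proof.
move=> p; apply: (@continuousD _ R^o _ (fun q : R * R => a + q.1 * b)).
  apply: (@continuousD _ R^o _ (fun=> a)); first exact: cst_continuous.
  apply: (@continuousM _ _ (fun q : R * R => q.1) (fun=> b)).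
    exact: cvg_fst.
  exact: cst_continuous.
apply: (@continuousM _ _ (fun q : R * R => q.2) (fun=> d)); first exact: cvg_snd.
exact: cst_continuous.
Qed.

(** The affine map from the triangle to [0, 1] that sends the vertices to [a],
    [b] and [d] composes with [g] to a singular 2-simplex with these edges. *)
Lemma is_boundary_subdivision (g : R -> X) (a b d : R) :
  {within `[0, 1], continuous g} -> 0 <= a <= 1 -> 0 <= b <= 1 -> 0 <= d <= 1 ->
  bd (fun h => simplex1 (seg g a b) h + simplex1 (seg g b d) h
               - simplex1 (seg g a d) h).
Proof.
move=> gc /andP[a0 a1] /andP[b0 b1] /andP[d0 d1].
pose f (p : R * R) := g (a + p.1 * (b - a) + p.2 * (d - a)).
have fc : {within @triangle R, continuous f}.
  pose F (p : R * R) := a + p.1 * (b - a) + p.2 * (d - a).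
  have Fc : {within @triangle R, continuous F}.
    exact/continuous_subspaceT/affine_continuous.
  have F01 p : @triangle R p -> `[0, 1]%classic (F p).
    by move=> [p1 p2 p12]; rewrite /F /= in_itv/=; apply/andP; split; nra.
  exact: within_comp Fc F01 gc.
apply: is_boundary_ext (is_boundary_triangle fc) => h.
rewrite /boundary2 addrAC [X in X + _ = _]addrC.
congr (_ + _ - _); apply: simplex1_ext => t _; rewrite /f /seg /=.
- by rewrite mul0r addr0.
- by congr g; ring.
- by rewrite mul0r addr0.
Qed.

(** The boundary of a constant 2-simplex is a single constant 1-simplex, as two
    of its three edges cancel. *)
Lemma is_boundary_cst (x : X) : bd (simplex1 (fun=> x)).
Proof.
have fc : {within @triangle R, continuous (fun=> x : X)}.
  by apply: continuous_subspaceT => ?; exact: cvg_cst.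
apply: is_boundary_ext (is_boundary_triangle fc) => h.
by rewrite /boundary2 subrr add0r.
Qed.

End Boundaries.

(** Compactness of [0, 1] in the form of a supremum argument: the supremum of
    the [t] with [P 0 t] is attained, and cannot be less than [1]. *)
Lemma interval_chain (R : realType) (P : R -> R -> Prop) :
  (forall a b d, 0 <= a -> a <= b -> b <= d -> d <= 1 ->
    P a b -> P b d -> P a d) ->
  (forall t, 0 <= t <= 1 -> exists2 e, 0 < e & forall a b,
    0 <= a -> t - e < a -> a <= t -> t <= b -> b < t + e -> b <= 1 -> P a b) ->
  P 0 1.
Proof.
move=> Ptrans Ploc; pose S := [set t | 0 <= t <= 1 /\ P 0 t].
have S0 : S 0.
  split; first by rewrite lexx ler01.
  by have [|e e0] := Ploc 0; [rewrite lexx ler01 | apply; rewrite ?ler01//; lra].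
have Sub : ubound S 1 by move=> t [/andP[]].
have hS : has_sup S by split; [exists 0 | exists 1].
have s0 : 0 <= sup S by apply: ub_le_sup => //; exists 1.
have s1 : sup S <= 1 by apply: ge_sup => //; exists 0.
have [|e e0 eP] := Ploc (sup S); first by rewrite s0.
have [t [/andP[t0 t1] Pt] ts] := sup_adherent e0 hS.
have tle : t <= sup S by apply: ub_le_sup; [exists 1 | split=> //; rewrite t0].
pose s' := Num.min (sup S + e / 2) 1.
have s's : sup S <= s' by rewrite le_min s1 lerDl divr_ge0// ltW.
have s'1 : s' <= 1 by rewrite ge_min lexx orbT.
have Ps' : P 0 s'.
  apply: (Ptrans 0 t) => //; first exact: le_trans s's.
  by apply: eP => //; rewrite gt_min; apply/orP; left; lra.
have : s' <= sup S.
  by apply: ub_le_sup; [exists 1 | split=> //; rewrite s'1 (le_trans s0)].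
rewrite /s' ge_min => /orP[|s1']; first by lra.
by move: Ps'; rewrite /s' min_r//; lra.
Qed.

(** * Loops in the necklace up to homology *)

Section NecklaceHomology.
Context (R : realType) (c : nat).
Local Notation N := (necklace R c).
Local Notation l := (circ R c).
Local Notation b := c.+1.
Local Notation bd := (@is_boundary R N).

(** The factors that [contr_pos] and [contr_ang] apply to the two coordinates
    contract the tree to its root: as the time [r] decreases from [1], the
    points first slide down to the spine, until [r = 1 / 2], and then along
    the spine. *)
Definition contr_pos (r : R) : R := Num.min (r + r) 1.
Definition contr_ang (r : R) : R := Num.max (r + r - 1) 0.

Definition ray (u s r : R) : N := npt c (contr_pos r * u) (contr_ang r * s).

Lemma contr_continuous : continuous contr_pos /\ continuous contr_ang.
Proof.
have dbl : continuous (fun r : R => r + r).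
  by move=> r; apply: (@continuousD _ R^o _ id id); exact: cvg_id.
split=> r.
  apply: (@continuous_min _ _ (fun r : R => r + r) (fun=> 1)); first exact: dbl.
  exact: cst_continuous.
apply: (@continuous_max _ _ (fun r : R => r + r - 1) (fun=> 0)).
  apply: (@continuousB _ R^o _ (fun r => r + r) (fun=> 1)); first exact: dbl.
  exact: cst_continuous.
exact: cst_continuous.
Qed.

(** While the position is being scaled, the other coordinate is zero, so the
    contraction does not leave the tree. *)
Lemma contr_in_tree u s r : in_tree c (u, s) -> 0 <= r ->
  in_tree c (contr_pos r * u, contr_ang r * s).
Proof.
move=> /andP[/= /andP[u0 uc] us] r0; rewrite /in_tree /= /contr_pos /contr_ang.
have [r1|r1] := leP (r + r) 1.
  rewrite max_r ?subr_le0// mul0r eqxx /= andbT.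
  by apply/andP; split; nra.
rewrite mul1r u0 uc /=; case/orP: us => [/eqP->|->]; last by rewrite orbT.
by rewrite mulr0 eqxx.
Qed.

Lemma contr0 : contr_pos 0 = 0 /\ contr_ang 0 = 0.
Proof.
rewrite /contr_pos /contr_ang addr0 sub0r.
by rewrite min_l ?ler01// max_r// oppr_le0 ler01.
Qed.

Lemma contr1 : contr_pos 1 = 1 /\ contr_ang 1 = 1.
Proof. by rewrite /contr_pos /contr_ang min_r ?max_l; lra. Qed.

(** Both triangles of the homotopy below are instances, with [f] the time of the
    contraction and [g] the parameter of the path. *)
Lemma ray_homotopy_continuous (a s : R -> R) (f g : R * R -> R) :
  {within `[0, 1], continuous a} -> {within `[0, 1], continuous s} ->
  (forall t : R, 0 <= t <= 1 -> in_tree c (a t, s t)) ->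
  continuous f -> continuous g ->
  (forall p, @triangle R p -> 0 <= f p /\ 0 <= g p <= 1) ->
  {within @triangle R, continuous (fun p => ray (a (g p)) (s (g p)) (f p))}.
Proof.
move=> ac sc as_tree fc gc fg; have [cpc cac] := contr_continuous.
have g01 p : @triangle R p -> `[0, 1]%classic (g p).
  by move=> /fg[_ ?]; rewrite /= in_itv.
have gc' : {within @triangle R, continuous g} by exact: continuous_subspaceT.
have prod (k : R -> R) (q : R -> R) : continuous k ->
    {within `[0, 1], continuous q} ->
    {within @triangle R, continuous (fun p => k (f p) * q (g p))}.
  move=> kc qc; have := within_comp gc' g01 qc.
  move=> /subspace_continuousP qgc; apply/subspace_continuousP => p Tp.
  apply: cvgM; last exact: qgc.
  apply: cvg_within_filter; apply: (@continuous_comp _ _ _ f k); first exact: fc.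
  exact: kc.
apply: npt_continuous; [exact: prod|exact: prod|].
by move=> p /fg[f0 g01']; apply: contr_in_tree f0; exact: as_tree.
Qed.

(** The contraction sweeps out a square whose sides are the path, the rays to
    its two end points, and a constant path. Its two halves are singular
    2-simplices sharing the diagonal. *)
Lemma tree_path_homologous (a s : R -> R) :
  {within `[0, 1], continuous a} -> {within `[0, 1], continuous s} ->
  (forall t : R, 0 <= t <= 1 -> in_tree c (a t, s t)) ->
  bd (fun h => simplex1 (fun t => npt c (a t) (s t) : N) h
    - (simplex1 (ray (a 1) (s 1)) h - simplex1 (ray (a 0) (s 0)) h)).
Proof.
move=> ac sc as_tree.
have fstc : continuous (fun p : R * R => p.1) by move=> p; exact: cvg_fst.
have sndc : continuous (fun p : R * R => p.2) by move=> p; exact: cvg_snd.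
have sumc : continuous (fun p : R * R => p.1 + p.2).
  move=> p; apply: (@continuousD _ R^o _ (fun q : R * R => q.1)); first exact: fstc.
  exact: sndc.
have tri (p : R * R) : @triangle R p ->
    [/\ 0 <= p.1 + p.2, 0 <= p.2, p.2 <= 1 & p.1 + p.2 <= 1].
  by move=> [? ? ?]; split; lra.
have h1 := ray_homotopy_continuous ac sc as_tree sumc sndc.
have h2 := ray_homotopy_continuous ac sc as_tree sndc sumc.
have {}h1 := is_boundary_triangle (h1 _).
have {}h2 := is_boundary_triangle (h2 _).
have bc := is_boundary_cst R (base R c).
have [cp0 ca0] := contr0; have [cp1 ca1] := contr1.
(* At time 0 all rays are at the root, which gives the constant side. *)
have base0 u v : ray u v 0 = base R c.
  rewrite /ray cp0 ca0 !mul0r; apply: necklace_eq.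
    by rewrite pos_npt// in_tree0// lexx ler0n.
  by rewrite ang_npt ?cmod0 ?circ_gt0// in_tree0// lexx ler0n.
apply: is_boundary_ext
  (is_boundaryD (is_boundaryB (h1 _) (h2 _)) bc) => [h|p /tri[]|p /tri[]];
  last 2 first.
- by move=> -> -> -> _.
- by move=> -> -> _ ->.
rewrite /boundary2 /=.
rewrite (@simplex1_ext _ _ _ (fun t => npt c (a t) (s t))); last first.
  by move=> t _; rewrite subrK /ray cp1 ca1 !mul1r.
rewrite (@simplex1_ext _ _ (fun t => ray (a (0 + t)) (s (0 + t)) t)
   (fun t => ray (a t) (s t) (0 + t))); last by move=> t _; rewrite add0r.
rewrite (@simplex1_ext _ _ (fun t => ray (a 0) (s 0) (t + 0)) (ray (a 0) (s 0)));
  last by move=> t _; rewrite addr0.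
rewrite (@simplex1_ext _ _ (fun t => ray (a (1 - t + t)) (s (1 - t + t)) t)
   (ray (a 1) (s 1))); last by move=> t _; rewrite subrK.
rewrite (@simplex1_ext _ _ (fun t => ray (a (t + 0)) (s (t + 0)) 0)
   (fun=> base R c)); last by move=> t _; rewrite base0.
by ring.
Qed.

(** The ray in the tree that goes once around the circle at [j], minus the ray
    that stops at its attaching point: homologous to the loop around that
    circle. *)
Definition turn (j : 'I_b) (h : R -> N) : R :=
  simplex1 (ray j%:R l) h - simplex1 (ray j%:R 0) h.

(** The segments from [s] to [0] and from [s + l] to [l] on the line at [j]
    have the same projection, and by [tree_path_homologous] that path is
    homologous to two differences of rays. *)
Lemma ray_turn (j : 'I_b) (s : R) : bd (fun h =>
  simplex1 (ray j%:R (s + l)) h - simplex1 (ray j%:R s) h - turn j h).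
Proof.
have lin (x y : R) : continuous (fun t : R => x * (1 - t) + y).
  move=> t; apply: (@continuousD _ R^o _ (fun t : R => x * (1 - t)) (fun=> y)).
    apply: (@continuousM _ _ (fun=> x) (fun t : R => 1 - t)).
      exact: cst_continuous.
    apply: (@continuousB _ R^o _ (fun=> 1) id); last exact: cvg_id.
    exact: cst_continuous.
  exact: cst_continuous.
have cc : {within `[0, 1], continuous (fun _ : R => j%:R : R)}.
  by apply: continuous_subspaceT => t; exact: cst_continuous.
have p y := @tree_path_homologous (fun=> j%:R) (fun t : R => s * (1 - t) + y) cc
  (continuous_subspaceT (lin s y)) (fun t _ => in_tree_post j _).
apply: is_boundary_ext (is_boundaryB (p l) (p 0)) => h.
rewrite /turn /= !subr0 !subrr !mulr0 !mulr1 !addr0 !add0r.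
rewrite (@simplex1_ext _ _ (fun t => npt c j%:R (s * (1 - t) + l))
  (fun t => npt c j%:R (s * (1 - t) + 0))); first by ring.
by move=> t _; rewrite -[X in _ + X]mul1r (nptDl _ 1) addr0.
Qed.

(** The chain attached to a point of the necklace by its standard lift to the
    tree; it plays the role of a potential, discontinuous at the antipodes
    only. *)
Definition phi (y : N) (h : R -> N) : R := simplex1 (ray (pos y) (ang y)) h.

Lemma cmod_path_continuous (p : R -> N) (k : R) :
  {within `[0, 1], continuous p} ->
  (forall t : R, 0 <= t <= 1 -> cnorm l (ang (p t) - k) < l / 2) ->
  {within `[0, 1], continuous (fun t => cmod l (ang (p t) - k))}.
Proof.
move=> /within_continuousE pc pk.
apply/(@within_continuousE R R^o) => x x01 e e0.
have x1 : 0 <= x <= 1 by move: x01; rewrite /= in_itv.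
have d0 : 0 < Num.min e (l / 2 - cnorm l (ang (p x) - k)).
  by rewrite lt_min e0 subr_gt0 pk.
have [d dp h] := pc x x01 _ d0; exists d => // y y01 xy.
have := h y y01 xy; rewrite lt_min => /andP[h1 h2].
have h3 := ang_dist (p y) (p x); rewrite ndist_sym in h3.
have E : ang (p y) - k - (ang (p x) - k) = ang (p y) - ang (p x) by ring.
have h4 := @cmod_near _ _ (circ_gt0 R c) (ang (p x) - k) (ang (p y) - k).
rewrite E in h4.
apply: le_lt_trans (h4 _) _; first exact: le_lt_trans h3 h2.
exact: le_lt_trans h3 h1.
Qed.

Lemma pos_path_continuous (p : R -> N) :
  {within `[0, 1], continuous p} ->
  {within `[0, 1], continuous (fun t => pos (p t))}.
Proof.
move=> /within_continuousE pc; apply/(@within_continuousE R R^o) => x x01 e e0.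
have [d dp h] := pc x x01 _ e0; exists d => // y y01 xy.
apply: le_lt_trans (h y y01 xy); rewrite /mdist /=.
by rewrite distrC; exact: pos_dist.
Qed.

(** A path avoiding the antipodes lifts by [ang]. A path of small oscillation
    that meets the antipode of [j] stays on the circle at [j] minus its
    attaching point, and lifts to the open interval from [0] to [l]; there
    the lift exceeds [ang] by [0] or [l], so each end point contributes at
    most one [turn j]. *)
Lemma short_path_homologous (p : R -> N) :
  {within `[0, 1], continuous p} ->
  (forall s t : R, 0 <= s <= 1 -> 0 <= t <= 1 -> mdist (p s) (p t) < l / 2) ->
  exists w : 'I_b -> R,
    bd (fun h => simplex1 p h - (phi (p 1) h - phi (p 0) h)
                 - \sum_j w j * turn j h) /\
    forall j, w j != 0 -> exists2 t, 0 <= t <= 1 & p t = npt c j%:R (l / 2).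
Proof.
move=> pc posc; have l0 := circ_gt0 R c.
have I0 : 0 <= (0 : R) <= 1 by rewrite lexx ler01.
have I1 : 0 <= (1 : R) <= 1 by rewrite lexx ler01.
have [[t0 t01 pt0]|nq] := pselect (exists2 t, 0 <= t <= 1 & ang (p t) = l / 2);
    last first.
  exists (fun=> 0); split=> [|j]; last by rewrite eqxx.
  have small t : 0 <= t <= 1 -> cnorm l (ang (p t) - 0) < l / 2.
    move=> t01; rewrite subr0 cnorm_ang ltr_norml.
    have [_ _ /andP[-> a2]] := necklaceP (p t).
    by rewrite lt_neqAle a2 andbT; apply/eqP => at1; apply: nq; exists t.
  have ac := cmod_path_continuous pc small.
  have angE : (fun t => cmod l (ang (p t) - 0)) = (fun t => ang (p t)).
    by apply/funext => t; rewrite subr0 cmod_ang.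
  rewrite angE in ac.
  have := tree_path_homologous (pos_path_continuous pc) ac
    (fun t _ => necklace_in_tree (p t)).
  apply: is_boundary_ext => h; rewrite big1 ?subr0 => [|j _]; last by rewrite mul0r.
  by congr (_ - _); apply: simplex1_ext => t _; rewrite npt_pos_ang.
have [_ /(_ _)/postP pj _] := necklaceP (p t0).
have [|j uj] := pj; first by rewrite pt0; apply/eqP; lra.
have near t : 0 <= t <= 1 ->
    pos (p t) = j%:R /\ cnorm l (ang (p t) - l / 2) < l / 2.
  move=> t1; have := posc t t0 t1 t01; rewrite mdistE /ndist uj pt0.
  case: eqVneq => // _; rewrite (gtr0_norm (divr_gt0 l0 _))//.
  by have := normr_ge0 (pos (p t) - j%:R); have := normr_ge0 (ang (p t)); lra.
(* The lift to the line at [j] that is continuous across the antipode. *)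
pose s t := l / 2 + cmod l (ang (p t) - l / 2).
have sc : {within `[0, 1], continuous s}.
  have := cmod_path_continuous pc (fun t t1 => (near t t1).2).
  move=> /subspace_continuousP cc; apply/subspace_continuousP => x x01.
  by apply: cvgD; [exact: cvg_cst | exact: cc].
have cc : {within `[0, 1], continuous (fun _ : R => j%:R : R)}.
  by apply: continuous_subspaceT => t; exact: cst_continuous.
have H := tree_path_homologous cc sc (fun t _ => in_tree_post j _).
have sE t : 0 <= t <= 1 -> s t = ang (p t) \/ s t = ang (p t) + l.
  move=> t1; have [_ nt] := near t t1.
  have [_ _ /andP[a1 a2]] := necklaceP (p t).
  have st : 0 < s t < l.
    move: nt; rewrite /cnorm ltr_norml => /andP[n1 n2].
    by rewrite /s; apply/andP; split; lra.
  have [an|ap] := leP (ang (p t)) 0.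
    have m1 : (-1)%:~R * l = - l by rewrite rmorphN1 mulN1r.
    right; rewrite /s (@cmod_unique _ _ l0 (-1)) m1; first by lra.
    apply/andP; split; last by lra.
    rewrite lt_neqAle; apply/andP; split; last by lra.
    apply/eqP => e; have a0 : ang (p t) = - (l / 2) by lra.
    by move: a1; rewrite a0 ltxx.
  left; rewrite /s (@cmod_id _ _ l0); first by lra.
  by apply/andP; split; lra.
have rE t : 0 <= t <= 1 -> exists k : R, bd (fun h =>
    simplex1 (ray j%:R (s t)) h - phi (p t) h - k * turn j h).
  move=> t1; have [pt _] := near t t1; rewrite /phi pt.
  have [->|->] := sE t t1.
    exists 0; apply: is_boundary_ext (is_boundary0 R _) => h.
    by rewrite subrr mul0r subr0.
  by exists 1; apply: is_boundary_ext (ray_turn j (ang (p t))) => h; rewrite mul1r.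
have [k0 H0] := rE 0 I0; have [k1 H1] := rE 1 I1.
exists (fun i => if i == j then k1 - k0 else 0); split; last first.
  move=> i; have [->|_] := eqVneq i j; last by rewrite eqxx.
  by move=> _; exists t0 => //; rewrite -[p t0]npt_pos_ang uj pt0.
apply: is_boundary_ext (is_boundaryD H (is_boundaryB H1 H0)) => h.
rewrite (bigD1 j)//= eqxx big1 => [|i /negbTE ->]; last by rewrite mul0r.
rewrite (@simplex1_ext _ _ (fun t => npt c j%:R (s t)) p); first by ring.
move=> t t1; have [pt _] := near t t1.
by rewrite -[RHS]npt_pos_ang pt; have [->|->] := sE t t1;
  rewrite // -[X in _ + X]mul1r (nptDl _ 1).
Qed.

(** Subdivide the loop into short paths; the potentials [phi] of the
    subdivision points telescope, and those of the two ends cancel. *)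
Lemma loop_homologous (g : R -> N) (x : N) : is_loop x g ->
  exists w : 'I_b -> R,
    bd (fun h => simplex1 g h - \sum_j w j * turn j h) /\
    forall j, w j != 0 -> exists2 t, 0 <= t <= 1 & g t = npt c j%:R (l / 2).
Proof.
move=> [gc g0 g1]; have l0 := circ_gt0 R c.
pose P (u v : R) := exists w : 'I_b -> R,
    bd (fun h => simplex1 (seg g u v) h - (phi (g v) h - phi (g u) h)
                 - \sum_j w j * turn j h) /\
    forall j, w j != 0 -> exists2 t, 0 <= t <= 1 & g t = npt c j%:R (l / 2).
have [|t t01|w [wb wv]] := @interval_chain R P.
- move=> u v z u0 uv vz z1 [w [wb wv]] [w' [wb' wv']].
  have sub := @is_boundary_subdivision _ _ g u v z gc.
  exists (fun j => w j + w' j); split.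
    apply: is_boundary_ext
      (is_boundaryB (is_boundaryD wb wb') (sub _ _ _)) => [h|||]; last 3 first.
    + by apply/andP; split; lra.
    + by apply/andP; split; lra.
    + by apply/andP; split; lra.
    have -> : \sum_j (w j + w' j) * turn j h =
        \sum_j w j * turn j h + \sum_j w' j * turn j h.
      by rewrite -big_split; apply: eq_bigr => j _; rewrite mulrDl.
    by ring.
  move=> j; have [wj|/wv//] := eqVneq (w j) 0.
  by rewrite wj add0r => /wv'.
- have l4 : 0 < l / 4 by rewrite divr_gt0.
  have t01' : `[0, 1]%classic t by rewrite /= in_itv.
  have [e e0 ge] := (within_continuousE _ _).1 gc t t01' _ l4.
  exists e => // u v u0 tu ut tv vt v1.
  have uv s : 0 <= s <= 1 -> u <= u + s * (v - u) <= v.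
    by move=> /andP[s0 s1]; apply/andP; split; nra.
  have inI s : 0 <= s <= 1 -> `[0, 1]%classic (u + s * (v - u)).
    by move=> /uv/andP[h1 h2]; rewrite /= in_itv/=; apply/andP; split; lra.
  have near s : 0 <= s <= 1 -> mdist (g t) (seg g u v s) < l / 4.
    move=> s1; apply: ge; first exact: inI.
    have /andP[h1 h2] := uv s s1.
    by rewrite /ball /= ltr_norml; apply/andP; split; lra.
  have segc : {within `[0, 1], continuous (seg g u v)}.
    have ac : {within `[0, 1], continuous (fun s : R => u + s * (v - u))}.
      apply: continuous_subspaceT => s.
      apply: (@continuousD _ R^o _ (fun=> u) (fun s : R => s * (v - u))).
        exact: cst_continuous.
      apply: (@continuousM _ _ id (fun=> v - u)); first exact: cvg_id.
      exact: cst_continuous.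
    apply: (within_comp ac _ gc) => s s01; apply: inI.
    by move: s01; rewrite /= in_itv.
  have [|w [wb wv]] := short_path_homologous segc.
    move=> s s' s1 s1'; apply: le_lt_trans (metric_triangle _ (g t) _) _.
    by rewrite metric_sym; have := near s s1; have := near s' s1'; lra.
  exists w; split.
    apply: is_boundary_ext wb => h; rewrite {2 3}/seg.
    by rewrite mul1r mul0r addr0 [u + _]addrC subrK.
  move=> j /wv[s s1 sj]; exists (u + s * (v - u)) => //.
  by have := inI s s1; rewrite /= in_itv.
exists w; split=> //; apply: is_boundary_ext wb => h.
rewrite g0 g1 subrr subr0; congr (_ - _); apply: simplex1_ext => t _.
by rewrite /seg subr0 mulr1 add0r.
Qed.

End NecklaceHomology.

(** * Counting the circles within reach *)

Section Count.
Context (R : realType) (c : nat).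
Local Notation N := (necklace R c).
Local Notation l := (circ R c).
Local Notation b := c.+1.

Definition posts_near (u r : R) : {set 'I_b} :=
  [set j : 'I_b | `|u - j%:R| <= r]%SET.

(** The differences with the smallest integer of the interval are at most
    [floor L]. *)
Lemma card_posts_near (u L : R) : 0 <= L ->
  #|posts_near u (L / 2)|%:Z <= Num.floor L + 1.
Proof.
move=> L0; set S := posts_near _ _; set K := `|Num.floor L|%N.
have KE : K%:Z = Num.floor L by rewrite gez0_abs// floor_ge0.
have [->|[j0 j0S]] := set_0Vmem S; first by rewrite cards0 -KE.
rewrite -KE -PoszD lez_nat addn1.
pose i := [arg min_(i < j0 in S) (i : nat)].
have [iS imin] : i \in S /\ forall j, j \in S -> (i <= j)%N.
  by rewrite /i; case: arg_minnP => // i' i'S i'min; split.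
have gap (j : 'I_b) : j \in S -> (j - i < K.+1)%N.
  move=> jS; have ij := imin j jS; rewrite ltnS -lez_nat KE floor_ge_int.
  rewrite -subzn// rmorphB /=.
  have : `|i%:R - j%:R| <= L :> R.
    apply: le_trans (ler_distD u _ _) _; move: iS jS; rewrite !inE distrC; lra.
  by rewrite distrC ger0_norm// subr_ge0 ler_nat.
have inj : {in S &, injective (fun j : 'I_b => inord (j - i) : 'I_K.+1)}.
  move=> j k jS kS /(congr1 val); rewrite /= !inordK ?gap// => jk.
  apply/val_inj/eqP; rewrite /= -(eqn_add2r (nat_of_ord i))%N.
  by rewrite -(subnK (imin j jS)) -(subnK (imin k kS)) jk.
by rewrite -(card_in_imset inj) -[leqRHS](card_ord K.+1) max_card.
Qed.

(** The loop has to travel to the antipode and back, and the position on the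
    spine is 1-Lipschitz. *)
Lemma loop_reach (g : R -> N) (x : N) (L t : R) (j : 'I_b) : is_loop x g ->
  (path_length g <= L%:E)%E -> 0 <= t <= 1 -> g t = npt c j%:R (l / 2) ->
  `|pos x - j%:R| <= L / 2.
Proof.
move=> [_ g0 g1] gL t01 gt.
have := le_trans (path_length_ge g t01) gL.
rewrite lee_fin g0 g1 gt !mdistE [X in _ + X]ndist_sym.
have := pos_dist x (npt c j%:R (l / 2)); rewrite pos_npt ?in_tree_post//.
by lra.
Qed.

(** Restricted to the circles within reach, the coefficients of [m] loops form
    a matrix with as many columns as there are such circles; a left kernel
    vector gives a combination of the loops that is a boundary. *)
Lemma independent_loops_le (x : N) (L : R) (m : nat) (g : 'I_m -> R -> N) :
  (forall i, is_loop x (g i)) ->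
  (forall i, (path_length (g i) <= L%:E)%E) ->
  homologically_independent g ->
  (m <= #|posts_near (pos x) (L / 2)|)%N.
Proof.
move=> gx gL gind; set S := posts_near _ _; rewrite leqNgt; apply/negP => Sm.
have /choice[w wP] i := loop_homologous (gx i).
have wS i j : j \notin S -> w i j = 0.
  apply: contraNeq => /(wP i).2[t t01 gt]; rewrite inE.
  exact: loop_reach (gx i) (gL i) t01 gt.
pose W : 'M[R]_(m, #|S|) := \matrix_(i, k) w i (enum_val k).
have : kermx W != 0.
  rewrite -mxrank_eq0 mxrank_ker subn_eq0 -ltnNge.
  exact: leq_ltn_trans (rank_leq_col W) Sm.
move=> /rowV0Pn[v /sub_kermxP vW /negP]; apply; apply/eqP/rowP => i; rewrite mxE.
apply: gind i.
have := is_boundary_sum (fun i => is_boundaryZ (v ord0 i) (wP i).1).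
apply: is_boundary_ext => h.
under eq_bigr do rewrite mulrBr mulr_sumr.
rewrite sumrB exchange_big /= [X in _ - X]big1 ?subr0// => j _.
have [jS|jS] := boolP (j \in S); last first.
  by rewrite big1// => i _; rewrite wS// mul0r mulr0.
have := congr1 (fun M : 'rV_#|S| => M ord0 (enum_rank_in jS j)) vW.
rewrite !mxE => vWj; under eq_bigr do rewrite mulrA.
rewrite -mulr_suml (_ : \sum_i _ = 0) ?mul0r// -[RHS]vWj.
by apply: eq_bigr => i _; rewrite mxE enum_rankK_in.
Qed.

End Count.

Unset Implicit Arguments.

Theorem theorem3p4 (R : realType) (b n : nat) (lambda : R)
    (hb : (2 <= b)%N) (hn1 : (1 <= n)%N) (hnb : (n <= b)%N)
    (hlambda : 0 < lambda) :
  exists Gamma : metricGraph R,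
    [/\ connected [set: Gamma],
        betti1 (mg_graph Gamma) = b%:Z,
        graph_length Gamma = (b%:R)%:E &
        forall (x : Gamma) (m : nat) (g : 'I_m -> R -> Gamma),
          (forall i, is_loop x (g i)) ->
          (forall i, (path_length (g i) <=
                      (lambda * (ln b%:R + n%:R))%:E)%E) ->
          homologically_independent g ->
          m%:Z <= Num.floor (lambda * (ln b%:R + n%:R)) + 1].
Proof.
case: b hb hnb => // c hb hnb; exists (necklace_mg R c); split.
- exact: necklace_connected.
- exact: betti1_necklace.
- exact: necklace_length.
- move=> x m g gx gL gind.
  apply: le_trans (card_posts_near c (pos x) _); last first.
    by rewrite mulr_ge0 ?(ltW hlambda)// addr_ge0// ln_ge0// ler1n.
  rewrite lez_nat; exact: independent_loops_le gx gL gind.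
Qed.
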